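(* Let $n\ge11$ with $n\ne12,14$. Then the group $H(n,3)$ is hyperbolic.
   Context: $H(n,3)=H_n(3,1)$ is the group defined by the presentation $\langle x_1,\ldots,x_n\mid x_ix_{i+3}=x_{i+1}\ (1\le i\le n)\rangle$, subscripts mod $n$. *)

(* Defs.v *)
From mathcomp Require Import all_boot.
Set Implicit Arguments. Unset Strict Implicit. Unset Printing Implicit Defensive.

(* A letter (i, false) stands for x_i, (i, true) for x_i^{-1}.
   Generators are indexed 0..n-1 (paper: 1..n), subscripts mod n. *)
Definition letter := (nat * bool)%type.
Definition inv_letter (a : letter) : letter := (a.1, ~~ a.2).
Definition valid_word (n : nat) (w : seq letter) : bool := all (fun a => a.1 < n) w.

Definition Hn3_relator (n i : nat) : seq letter :=
  [:: (i, false); ((i + 3) %% n, false); ((i + 1) %% n, true)].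

Inductive Hn3_eq (n : nat) : seq letter -> seq letter -> Prop :=
| Hn3_refl u : Hn3_eq n u u
| Hn3_sym u v : Hn3_eq n u v -> Hn3_eq n v u
| Hn3_trans u v w : Hn3_eq n u v -> Hn3_eq n v w -> Hn3_eq n u w
| Hn3_free u v a : Hn3_eq n (u ++ a :: inv_letter a :: v) (u ++ v)
| Hn3_rel u v i : i < n -> Hn3_eq n (u ++ Hn3_relator n i ++ v) (u ++ v).

Definition Hn3_dist (n : nat) (u v : seq letter) (k : nat) : Prop :=
  (exists w, [/\ valid_word n w, size w = k & Hn3_eq n (u ++ w) v]) /\
  (forall w, valid_word n w -> Hn3_eq n (u ++ w) v -> k <= size w).

(* Gromov delta-hyperbolicity of a metric given as a relation on the points
   satisfying P (four-point condition, equivalent to the Gromov-product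
   inequality (x|y)_w >= min((x|z)_w,(y|z)_w) - delta). *)
Definition gromov_hyperbolic (T : Type) (P : T -> Prop)
  (dist : T -> T -> nat -> Prop) : Prop :=
  exists delta : nat, forall x y z w, P x -> P y -> P z -> P w ->
    forall dxy dzw dxz dyw dxw dyz,
      dist x y dxy -> dist z w dzw -> dist x z dxz -> dist y w dyw ->
      dist x w dxw -> dist y z dyz ->
      dxy + dzw <= maxn (dxz + dyw) (dxw + dyz) + 2 * delta.

Definition Hn3_hyperbolic (n : nat) : Prop :=
  gromov_hyperbolic (fun u => valid_word n u) (Hn3_dist n).

(* Main.v *)
(* The idea is a linear isoperimetric inequality for van Kampen diagrams over the
   triangular relators. The link of a vertex of the Cayley complex is the
   generalised Petersen graph GP(n,2), whose closed reduced paths, for the given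
   n, have length 5 or at least 8. So in a minimal diagram the only positively
   curved interior vertices have degree 5. No triangle has three such vertices,
   and distributing the angles suitably (with unequal angles at the vertices of
   degree 5) makes all interior vertices of degree at least 8 strictly negatively
   curved; this is checked on the finitely many closed paths of length at most 10.

   To deduce hyperbolicity, consider a loop made of a geodesic through p and of a
   path at distance at least 2R from p. For every radius s < 2R and every t < 2s a
   parity count finds a triangle of any filling which sits on the sphere of radius
   s around p and crosses the level t, and these triangles are distinct. Hence
   the length of the loop is at least quadratic in R. In a geodesic triangle with
   optimal slimness constant D this applies to a loop of length O(D) with R of
   order D, which bounds D; slim triangles give the four-point condition. *)

Require Import Defs.
From mathcomp Require Import all_boot zify.
From mathcomp Require Import boolp.

Set Implicit Arguments. Unset Strict Implicit. Unset Printing Implicit Defensive.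

(** * Planar fillings of words *)

(** No topology of the disc is used: a diagram is a derivation consuming its boundary word edge by
    edge. Planarity then means that gluing two boundary edges leaves two independent words, and
    Euler's formula is an induction. The price is a distinguished first edge, whose choice must be
    shown to be immaterial. Only the discharging needs vertices, and for it the derivation is
    enriched to a combinatorial map on named darts. The conditions on [n] enter at a single point.
    Around an interior vertex the total shift of the indices is a multiple of [n], so for the given
    [n] it is [0] or at least [11], and neither [12] nor [14]. Testing all paths with such shifts is
    one finite computation valid for all these [n]. In the second half the area is bounded below
    modulo 2, so that neither orientation nor embeddedness of the filling matters. *)

Lemma inv_letterK : involutive inv_letter.
Proof. by case=> i o; rewrite /inv_letter /= negbK. Qed.

(* A side of a triangle is a pair of a relator index [i] and [(o, k)], where [k]
   is the place of the side in the relator and [o] tells whether the triangle is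
   read backwards. [k = 3] encodes a side of the outer face, labelled [(i, o)]. *)
Definition side := (nat * bool * nat)%type.

Definition side_lab n (x : side) : letter :=
  let: (i, o, k) := x in
  match k with
  | 0 => (i, o)
  | 1 => ((i + 3) %% n, o)
  | 2 => ((i + 1) %% n, ~~ o)
  | _ => (i, o)
  end.

Definition next_place (o : bool) (k : nat) : nat := (k + (if o then 2 else 1)) %% 3.

Definition side_next (x : side) : side :=
  let: (i, o, k) := x in (i, o, next_place o k).

Definition tri_side n (x : side) : bool := (x.1.1 < n) && (x.2 < 3).

Lemma side_nextK x : x.2 < 3 -> side_next (side_next (side_next x)) = x.
Proof. by case: x => [[i o] [|[|[|k]]]] //=; case: o. Qed.

Lemma tri_side_next n x : tri_side n x -> tri_side n (side_next x).
Proof.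
by case: x => [[i o] [|[|[|k]]]]; rewrite /tri_side /= ?andbF //; case: o.
Qed.

Inductive rel3 n : letter -> letter -> letter -> Prop :=
| Rel3 x of tri_side n x :
    rel3 n (side_lab n x) (side_lab n (side_next x)) (side_lab n (side_next (side_next x))).

Lemma rel3_rot n a b c : rel3 n a b c -> rel3 n b c a.
Proof.
case=> x hx; have /andP[_ hk] := hx; rewrite -{3}(side_nextK hk).
by constructor; exact: tri_side_next.
Qed.

Lemma rel3_inv n a b c : rel3 n a b c -> rel3 n (inv_letter c) (inv_letter b) (inv_letter a).
Proof.
case=> [[[i o] k]] /andP[/= hi hk].
case: k hk => [|[|[|k]]] // _; case: o;
  [have := @Rel3 n (i, false, 1) | have := @Rel3 n (i, true, 2)
  |have := @Rel3 n (i, false, 2) | have := @Rel3 n (i, true, 0)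
  |have := @Rel3 n (i, false, 0) | have := @Rel3 n (i, true, 1)];
  by apply; rewrite /tri_side hi.
Qed.

(* [fill n w N]: the word [w] bounds a planar diagram with [N] triangles. The
   diagram is peeled at the first boundary edge, which either lies on a triangle
   or is glued to another boundary edge. *)
Inductive fill n : seq letter -> nat -> Prop :=
| fill_nil : fill n [::] 0
| fill_tri a p q w N : rel3 n (inv_letter a) p q -> fill n (p :: q :: w) N ->
    fill n (a :: w) N.+1
| fill_pair a u v N1 N2 : fill n u N1 -> fill n v N2 ->
    fill n (a :: u ++ inv_letter a :: v) (N1 + N2).

Lemma fill_inv n a w N : fill n (a :: w) N ->
  (exists p q M, [/\ rel3 n (inv_letter a) p q, fill n (p :: q :: w) M & N = M.+1])
  \/ (exists u v N1 N2, [/\ w = u ++ inv_letter a :: v, fill n u N1, fill n v N2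
        & N = N1 + N2]).
Proof.
move=> H; inversion H; subst.
  by left; exists p, q, N0.
by right; exists u, v, N1, N2.
Qed.

Lemma fill_cat n u v N M : fill n u N -> fill n v M -> fill n (u ++ v) (N + M).
Proof.
move=> fu fv; elim: fu => {u N} [//|a p q w N r _ IH|a u w N1 N2 f1 _ _ IH].
  by rewrite addSn; exact: fill_tri r IH.
by rewrite /= -catA -addnA; exact: fill_pair f1 IH.
Qed.

Lemma cat_cons_split (T : eqType) (x : T) u v s t : s ++ t = u ++ x :: v ->
  (exists v1, s = u ++ x :: v1 /\ v = v1 ++ t) \/
  (exists u2, u = s ++ u2 /\ t = u2 ++ x :: v).
Proof.
elim: s u => [|y s IH] u /=; first by move=> ->; right; exists u.
case: u => [|z u] /= [<-].
  by move=> <-; left; exists s.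
move=> /IH [[v1 [-> ->]]|[u2 [-> ->]]]; first by left; exists v1.
by right; exists u2.
Qed.

Lemma fill_eq n u v N : fill n u N -> u = v -> fill n v N.
Proof. by move=> h <-. Qed.

(** Peelings at two neighbouring edges commute, so the first edge plays no special role. Peeling a
    triangle trades one letter for two, hence lowers twice the area plus the length by one; this is
    the induction measure. *)
Lemma fill_rot1 n a w N : fill n (a :: w) N -> fill n (rcons w a) N.
Proof.
have [m] := ubnP (2 * N + size w).
elim: m a w N => // m IH a [//|b w] N; rewrite ltnS => hm fN.
have -> : rcons (b :: w) a = b :: w ++ [:: a] by rewrite -cats1.
have IHs u v M : 2 * M + (size u + size v) <= 2 * N + size w + 1 ->
    fill n (u ++ v) M -> fill n (v ++ u) M.
  elim: u v => [|x u IHu] v /= hs; first by rewrite cats0.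
  move=> /IH; rewrite size_cat rcons_cat => /(_ _) h.
  rewrite -cat_rcons; apply: IHu; first by rewrite size_rcons; lia.
  by apply: h; move: hs hm => /=; lia.
case: (fill_inv fN) => [[p [q [M [r f eN]]]]|[u [v [N1 [N2 [e f1 f2 eN]]]]]].
- have /= {}f : fill n ([:: b] ++ w ++ [:: p; q]) M.
    by rewrite catA; apply: (IHs [:: p; q]) => //=; lia.
  case: (fill_inv f) => [[c [d [M' [r' f' eM]]]]|[u [v [N1 [N2 [e f1 f2 eM]]]]]].
  + subst; apply: (fill_tri r').
    apply: (IHs [:: a] [:: c, d & w]) => /=; first by lia.
    apply: (fill_tri r).
    have /= := IHs [:: c, d & w] [:: p; q] M'; apply => //=; lia.
  + case: (cat_cons_split e) => [[v1 [ew ev]]|[u2 [eu epq]]].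
      subst; rewrite /= -catA -addnS; apply: fill_pair => //.
      apply: (IHs [:: a] v1).
        by rewrite /= size_cat /= in hm *; lia.
      apply: (fill_tri r); apply: (IHs v1 [:: p; q]) => //=.
      by rewrite size_cat /= in hm *; lia.
    (* Here [b] is glued to [p] or [q], so the triangle at [a] also lies on [b]. It is peeled there
       instead, and its side towards [a] is then glued to [a]. *)
    case: u2 eu epq => [|x [|y [|z u2]]] eu [] //.
    * move=> ep eq'; subst p v u.
      have r2 : rel3 n (inv_letter b) q (inv_letter a) by exact: rel3_rot r.
      rewrite eN; apply: (fill_tri r2).
      apply: (IHs (inv_letter a :: w ++ [:: a]) [:: q]) => /=.
        by rewrite size_cat /=; lia.
      rewrite -catA /= eM; rewrite cats0 in f1; have := fill_pair (inv_letter a) f1 f2.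
      by rewrite inv_letterK.
    * move=> ? eq' ev; subst x q v u.
      have r2 : rel3 n (inv_letter b) (inv_letter a) p by do 2!apply: rel3_rot.
      rewrite eN; apply: (fill_tri r2).
      have f1' := IHs w [:: p] N1 _ f1.
      rewrite eM; have := fill_pair (inv_letter a) (f1' _) f2.
      by rewrite inv_letterK; apply => /=; lia.
- case: u e f1 => [|b' u] /= [eb ew] f1.
    subst; inversion f1; subst.
    have := fill_pair (inv_letter a) f2 f1.
    by rewrite inv_letterK addnC.
  subst b'.
  case: (fill_inv f1) => [[c [d [M' [r' f' eM]]]]|[x [y [M1 [M2 [e f1' f2' eM]]]]]].
    subst; rewrite addSn; apply: (fill_tri r').
    apply: (IHs [:: a] [:: c, d & u ++ inv_letter a :: v]) => /=.
      by rewrite !size_cat /= in hm *; lia.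
    exact: (fill_pair a f' f2).
  subst; rewrite -addnA.
  apply: (@fill_eq _ (b :: x ++ inv_letter b :: (y ++ inv_letter a :: v) ++ [:: a])); last first.
    by rewrite -!catA /= -?catA.
  apply: fill_pair => //.
  apply: (IHs [:: a]) => /=; last exact: fill_pair.
  by rewrite !size_cat /= ?size_cat /= in hm *; lia.
Qed.

Lemma fill_rot n u v N : fill n (u ++ v) N -> fill n (v ++ u) N.
Proof.
elim: u v => [|x u IHu] v /=; first by rewrite cats0.
by move=> /fill_rot1; rewrite rcons_cat -cat_rcons; exact: IHu.
Qed.

(** Gluing two boundary edges together adds no triangle. For empty [v] it closes the diagram to a
    sphere, which is discarded; hence an inequality only. *)
Lemma fill_fold n v a N : fill n (v ++ [:: a; inv_letter a]) N ->
  exists2 M, M <= N & fill n v M.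
Proof.
have [m] := ubnP (2 * N + size v).
elim: m v a N => // m IH [|b v] a N; first by exists 0 => //; constructor.
rewrite ltnS /= => hm fN.
case: (fill_inv fN) => [[p [q [M [r f eN]]]]|[u [w [N1 [N2 [e f1 f2 eN]]]]]].
  have [||M' hM' f'] := IH [:: p, q & v] a M; [by move=> /=; lia | by [] |].
  by exists M'.+1; [lia | exact: fill_tri f'].
case: (cat_cons_split e) => [[v1 [ew ev]]|[u2 [eu epq]]].
  subst; have [|M' hM' f'] := IH v1 a N2 _ f2.
    by move: hm; rewrite size_cat /=; lia.
  by exists (N1 + M'); [lia | exact: fill_pair].
case: u2 eu epq => [|x [|y u2]] eu epq; last by case: u2 {eu} epq.
- have ea : a = inv_letter b := congr1 (head a) epq.
  have ew : [:: inv_letter a] = w := congr1 behead epq.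
  subst; rewrite inv_letterK cats0 in f1 f2.
  by exists (N1 + N2) => //; rewrite addnC; exact: (fill_cat f2 f1).
- have ea : a = x := congr1 (head a) epq.
  have /(can_inj inv_letterK) eb : inv_letter a = inv_letter b := congr1 (nth a ^~ 1) epq.
  subst; exists N1; first by lia.
  exact: (@fill_rot n v [:: b]).
Qed.

Lemma fill_fold_at n u v a N : fill n (u ++ a :: inv_letter a :: v) N ->
  exists2 M, M <= N & fill n (u ++ v) M.
Proof.
rewrite -[_ :: _ :: v]/([:: a; inv_letter a] ++ v) catA => /fill_rot; rewrite catA.
by case/fill_fold=> M hM /fill_rot f; exists M.
Qed.

Definition fillable n w := exists N, fill n w N.

(** Van Kampen's lemma. Since [Hn3_eq] is closed under symmetry, an equivalence is carried through
    all contexts. A relator is removed by placing a triangle with the inverse boundary in front of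
    it and folding three times. *)
Lemma fillable_eq n w : Hn3_eq n w [::] -> fillable n w.
Proof.
have rotE u v : fillable n (u ++ v) -> fillable n (v ++ u).
  by case=> N /fill_rot; exists N.
have ctx (P Q : seq letter) : (forall w, fillable n (P ++ w) <-> fillable n (Q ++ w)) ->
    forall x y, fillable n (x ++ P ++ y) <-> fillable n (x ++ Q ++ y).
  move=> h x y; split=> /rotE; rewrite -catA => /h; rewrite catA => /rotE; by [].
suff main u v : Hn3_eq n u v -> forall x y, fillable n (x ++ u ++ y) <-> fillable n (x ++ v ++ y).
  move=> /main /(_ [::] [::]) [_]; rewrite /= cats0; apply.
  by exists 0; constructor.
elim=> {u v w} //.
- by move=> u v _ IH x y; symmetry.
- by move=> u v w _ IH1 _ IH2 x y; rewrite IH1.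
- move=> u v a x y; rewrite -!catA !(catA x) /=.
  apply: (ctx [:: a; inv_letter a] [::]) => w /=; split=> [[N f]|[N f]].
    by have [M _ {}f] := @fill_fold_at n [::] w a N f; exists M.
  exists N; apply: (@fill_pair n a [::] w 0 N) => //; constructor.
- move=> u v i hi x y; rewrite -!catA !(catA x).
  apply: (ctx (Hn3_relator n i) [::]) => w.
  have r : rel3 n (i, false) ((i + 3) %% n, false) ((i + 1) %% n, true).
    by apply: (@Rel3 n (i, false, 0)); rewrite /tri_side hi.
  set a := (i, false) in r *; set b := (_, false) in r *; set c := (_, true) in r *.
  split=> [[N f]|[N f]].
    have f' : fill n [:: inv_letter c; inv_letter b; inv_letter a] 1.
      have r' : rel3 n (inv_letter (inv_letter c)) a b.
        by rewrite inv_letterK; do 2!apply: rel3_rot.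
      apply: (fill_tri r').
      apply: (@fill_pair n a [:: b; inv_letter b] [::] 0 0); last by constructor.
      by apply: (@fill_pair n b [::] [::] 0 0); constructor.
    have /= {f'}f := fill_cat f' f.
    have [M1 _ f1] := @fill_fold_at n [:: inv_letter c; inv_letter b] [:: b, c & w] (inv_letter a) _ f.
    have [M2 _ f2] := @fill_fold_at n [:: inv_letter c] (c :: w) (inv_letter b) _ f1.
    have [M3 _ f3] := @fill_fold_at n [::] w (inv_letter c) _ f2.
    by exists M3.
  exists N.+1.
  have r2 : rel3 n (inv_letter a) (inv_letter c) (inv_letter b).
    by do 2!apply: rel3_rot; apply: rel3_inv.
  apply: (fill_tri r2).
  have h := @fill_pair n (inv_letter b) [::] (c :: w).
  have := @fill_pair n (inv_letter c) [:: inv_letter b; b] w 0 N.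
  rewrite inv_letterK /=; apply=> //.
  have := @fill_pair n (inv_letter b) [::] [::] 0 0; rewrite inv_letterK /=.
  by apply; constructor.
Qed.

(** * Fillings with named darts *)

(* A dart is a side of a face together with an identifier of that face. It also
   stands for the corner of the face at the origin of the side. *)
Definition dart := (nat * side)%type.
Definition dlab n (x : dart) : letter := side_lab n x.2.
Definition dnext (x : dart) : dart := (x.1, side_next x.2).
Definition tri_darts (f : dart) : seq dart := [:: f; dnext f; dnext (dnext f)].
Definition tris (T : seq dart) := flatten (map tri_darts T).
Definition pend (s : seq (dart * seq dart)) := map fst s.
Definition ends (E : seq (dart * dart)) := flatten [seq [:: p.1; p.2] | p <- E].
Definition edge (E : seq (dart * dart)) x y := ((x, y) \in E) || ((y, x) \in E).

(* [diag n h s L E T] records a filling with named darts. The boundary still to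
   be filled is [s]; after each of its darts comes the list of those corners at
   its end point which are already known, and [h] lists such corners at the base
   point. [L] lists the vertices as cyclic lists of corners, [E] the glued pairs
   and [T] one dart for each triangle. *)
Inductive diag n : seq dart -> seq (dart * seq dart) -> seq (seq dart) ->
    seq (dart * dart) -> seq dart -> Prop :=
| diag_nil h : diag n h [::] [:: h] [::] [::]
| diag_tri h d g s L E T f : tri_side n f.2 -> dlab n f = inv_letter (dlab n d) ->
    diag n (rcons h d) ((dnext f, [::]) :: (dnext (dnext f), f :: g) :: s) L E T ->
    diag n h ((d, g) :: s) L ((d, f) :: E) (f :: T)
| diag_pair h d g u d' g' v L1 L2 E1 E2 T1 T2 : dlab n d' = inv_letter (dlab n d) ->
    diag n (d' :: g) u L1 E1 T1 -> diag n (h ++ d :: g') v L2 E2 T2 ->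
    diag n h ((d, g) :: u ++ (d', g') :: v) (L1 ++ L2) ((d, d') :: E1 ++ E2) (T1 ++ T2).

Lemma rel3_dart n f : tri_side n f.2 ->
  rel3 n (dlab n f) (dlab n (dnext f)) (dlab n (dnext (dnext f))).
Proof. by case: f => m x /= h; constructor. Qed.

Lemma diag_fill n h s L E T : diag n h s L E T -> fill n (map (dlab n) (pend s)) (size T).
Proof.
elim=> {h s L E T} [h|h d g s L E T f tf lf _ IH|h d g u d' g' v L1 L2 E1 E2 T1 T2 ll _ IH1 _ IH2].
- by constructor.
- by apply: fill_tri IH; rewrite -lf; exact: rel3_dart.
- by rewrite /= /pend !map_cat /= ll size_cat; exact: fill_pair IH1 IH2.
Qed.

(** [b] supplies fresh identifiers: the two parts of a glued diagram receive consecutive intervals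
    of them. *)
Lemma fill_diag n w N : fill n w N -> forall b h s, map (dlab n) (pend s) = w ->
  exists L E T, [/\ diag n h s L E T, size T = N, uniq (map fst T)
    & all (fun f => (b <= f.1 < b + N) && tri_side n f.2) T].
Proof.
elim=> {w N} [|a p q w N r _ IH|a u w N1 N2 _ IH1 _ IH2] b h s.
- by case: s => // _; exists [:: h], [::], [::]; split => //; constructor.
- case: s => [//|[d g] s] /= [ea ew].
  move: r ew; move E1 : (inv_letter a) => ia r; case: r E1 IH => x hx ea' IH ew.
  pose f : dart := (b, x).
  have [|L [E [T [dT sT uT aT]]]] := IH b.+1 (rcons h d) ((dnext f, [::]) :: (dnext (dnext f), f :: g) :: s).
    by rewrite /= -ew.
  exists L, ((d, f) :: E), (f :: T); split => /=.
  + by apply: diag_tri dT => //; rewrite ea /dlab /= ea'.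
  + by rewrite sT.
  + rewrite uT andbT; apply/negP => /mapP [y yT eb]; move/allP: aT => /(_ _ yT).
    by rewrite -eb /= ltnn.
  + rewrite leqnn hx /= -[X in X < _]addn0 ltn_add2l /=.
    by apply: sub_all aT => y; case/andP => hy ->; rewrite andbT; lia.
- case: s => [//|[d g] s] /= [ea es].
  have [u' [[d' g'] [v' [es' eu el ev]]]] : exists u' c v', [/\ s = u' ++ c :: v',
     map (dlab n) (pend u') = u, dlab n c.1 = inv_letter a & map (dlab n) (pend v') = w].
    elim: u s es {IH1 IH2 g} => [|y u IHu] [|c s] //= [e1 e2].
      by exists [::], c, s.
    have [u' [c' [v' [-> eu el ev]]]] := IHu s e2.
    by exists (c :: u'), c', v'; split => //=; rewrite e1 eu.
  have [L1 [E1 [T1 [dT1 sT1 uT1 aT1]]]] := IH1 b (d' :: g) u' eu.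
  have [L2 [E2 [T2 [dT2 sT2 uT2 aT2]]]] := IH2 (b + N1) (h ++ d :: g') v' ev.
  exists (L1 ++ L2), ((d, d') :: E1 ++ E2), (T1 ++ T2); split.
  + by rewrite es'; apply: diag_pair => //; rewrite el ea.
  + by rewrite size_cat sT1 sT2.
  + rewrite map_cat cat_uniq uT1 uT2 andbT /=; apply/hasPn => y /mapP [z zT ->].
    apply/negP => /mapP [t tT et].
    by move/allP: aT1 => /(_ _ tT); move/allP: aT2 => /(_ _ zT); lia.
  + rewrite all_cat; apply/andP; split; [apply: sub_all aT1|apply: sub_all aT2] => y;
      case/andP => hy ->; rewrite andbT; lia.
Qed.

Lemma diag_ends n h s L E T : diag n h s L E T -> perm_eq (ends E) (pend s ++ tris T).
Proof.
elim=> {h s L E T} [h|h d g s L E T f tf lf _ IH|h d g u d' g' v L1 L2 E1 E2 T1 T2 ll _ IH1 _ IH2] //.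
- apply/permP => P; move/permP/(_ P): IH.
  by rewrite /ends /tris /= !count_cat /= => ->; lia.
- apply/permP => P; move/permP/(_ P): IH1; move/permP/(_ P): IH2.
  rewrite /ends /tris /pend /= !map_cat !flatten_cat /= !count_cat /= => -> ->.
  by rewrite ?count_cat; lia.
Qed.

Lemma diag_leaves n h s L E T : diag n h s L E T ->
  perm_eq (flatten L) (h ++ pend s ++ flatten (map snd s) ++ tris T).
Proof.
elim=> {h s L E T} [h|h d g s L E T f tf lf _ IH|h d g u d' g' v L1 L2 E1 E2 T1 T2 ll _ IH1 _ IH2] //.
- apply/permP => P; move/permP/(_ P): IH.
  by rewrite /tris /= -cats1 !count_cat /= ?count_cat /= ?count_cat => ->; lia.
- apply/permP => P; move/permP/(_ P): IH1; move/permP/(_ P): IH2.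
  rewrite /tris /pend /= !map_cat !flatten_cat /= !count_cat /= ?count_cat /= => -> ->.
  by lia.
Qed.

(** Euler's formula [V - E + F = 2], with [2 E] equal to the boundary length plus three times the
    number of triangles, and the outer face counted in [F]. This is all that the discharging uses of
    planarity. *)
Lemma diag_euler n h s L E T : diag n h s L E T -> 2 * size L = size s + size T + 2.
Proof.
elim=> {h s L E T} [h|h d g s L E T f tf lf _ IH|h d g u d' g' v L1 L2 E1 E2 T1 T2 ll _ IH1 _ IH2] //.
- by rewrite IH /=; lia.
- by rewrite /= !size_cat /= mulnDr IH1 IH2; lia.
Qed.

Lemma diag_lab n h s L E T : diag n h s L E T ->
  {in E, forall p, dlab n p.2 = inv_letter (dlab n p.1)}.
Proof.
elim=> {h s L E T} [h|h d g s L E T f tf lf _ IH|h d g u d' g' v L1 L2 E1 E2 T1 T2 ll _ IH1 _ IH2] p //.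
- by rewrite inE => /predU1P [-> //|/IH].
- by rewrite inE mem_cat => /predU1P [-> //|/orP [/IH1|/IH2]].
Qed.

(** * Rotation of the corners around a vertex *)

Section Cycles.

Variables (next_ e : dart -> dart).
Hypothesis eK : involutive e.
Let follows x y := y == next_ (e x).

(* Every list of corners is a path of [follows]; the one after the dart [d] of
   the boundary continues from [e d]. *)
Fixpoint chains x g (s : seq (dart * seq dart)) (tl : seq dart) : bool :=
  if s is (d, g') :: s' then path follows x (rcons g d) && chains (e d) g' s' tl
  else path follows x (g ++ tl).

Definition well_chained h (s : seq (dart * seq dart)) : bool :=
  if s is (d, g) :: s' then chains (e d) g s' (rcons h d)
  else (h != [::]) && cycle follows h.

Lemma chains_tail x g s tl y t :
  chains x g s (rcons tl y ++ t) = chains x g s (rcons tl y) && path follows y t.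
Proof.
elim: s x g => [|[d g'] s IH] x g /=; last by rewrite IH andbA.
by rewrite catA cat_path -rcons_cat last_rcons.
Qed.

Lemma chains_cat x g u d g' v tl :
  chains x g (u ++ (d, g') :: v) tl = chains x g u [:: d] && chains (e d) g' v tl.
Proof.
by elim: u x g => [|[d2 g2] u IH] x g /=; rewrite ?cats1 // IH andbA.
Qed.

Lemma chains_cons x f g s tl : chains x (f :: g) s tl = follows x f && chains f g s tl.
Proof. by case: s => [|[d g'] s] //=; rewrite andbA. Qed.

(** [well_chained] is the invariant of peeling: the known corners at a boundary vertex already
    follow one another in the rotation, so they form a full turn when the vertex leaves the
    boundary. *)
Lemma diag_cycle n h s L E T : diag n h s L E T ->
  {in E, forall p, e p.1 = p.2} -> {in tris T, forall x, next_ x = dnext x} ->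
  well_chained h s -> {in L, forall l, (l != [::]) && cycle follows l}.
Proof.
elim=> {h s L E T} [h|h d g s L E T f tf lf _ IH|h d g u d' g' v L1 L2 E1 E2 T1 T2 ll _ IH1 _ IH2] he hn hw.
- by move=> l; rewrite inE => /eqP ->.
- have e1 : e d = f by apply: (he (d, f)); rewrite inE eqxx.
  have e2 : e f = d by rewrite -e1 eK.
  have nf : next_ f = dnext f by apply: hn; rewrite /tris /= !inE eqxx.
  have nf1 : next_ (dnext f) = dnext (dnext f) by apply: hn; rewrite /tris /= !inE eqxx orbT.
  have nf2 : next_ (dnext (dnext f)) = f.
    rewrite hn; last by rewrite /tris /= !inE eqxx !orbT.
    by move: tf; case: (f) => m x /andP [_ h3]; rewrite /dnext /= side_nextK.
  apply: IH.
  + by move=> p pE; apply: he; rewrite inE pE orbT.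
  + by move=> x xT; apply: hn; rewrite /tris /= !inE [x \in _]xT !orbT.
  rewrite /= chains_cons -(cats1 (rcons h d)) chains_tail /= andbT /follows !eK.
  by rewrite nf1 nf2 e1 nf !eqxx -e1 /= andbT.
- have e1 : e d = d' by apply: (he (d, d')); rewrite inE eqxx.
  have e2 : e d' = d by rewrite -e1 eK.
  move: hw; rewrite /= chains_cat e1 e2 => /andP [hu hv].
  move=> l; rewrite mem_cat => /orP [lL|lL].
    apply: (IH1 _ _ _ l lL).
    + by move=> p pE; apply: he; rewrite inE mem_cat pE orbT.
    + by move=> x xT; apply: hn; rewrite /tris map_cat flatten_cat mem_cat [x \in _]xT.
    case: u hu {IH1} => [|[d2 g2] u] /=; first by rewrite cats1.
    by case/andP => h1 h2; rewrite (chains_tail _ _ _ [::]) h2.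
  apply: (IH2 _ _ _ l lL).
  + by move=> p pE; apply: he; rewrite inE mem_cat pE !orbT.
  + by move=> x xT; apply: hn; rewrite /tris map_cat flatten_cat mem_cat [x \in flatten (map _ T2)]xT orbT.
  case: v hv {IH2} => [|[d2 g2] v] /=.
    move=> hc; apply/andP; split; first by case: (h).
    by rewrite -(rot_cycle (size h)) rot_size_cat /= rcons_cat.
  by case/andP => h1 h2; rewrite -cat_rcons rcons_cat chains_tail h2.
Qed.

End Cycles.

(** * Peeling and cutting a diagram at arbitrary edges *)

Lemma mem_ends E x y : edge E x y -> (x \in ends E) && (y \in ends E).
Proof.
have mE p : p \in E -> (p.1 \in ends E) && (p.2 \in ends E).
  by move=> pE; apply/andP; split; apply/flattenP; exists [:: p.1; p.2];
     rewrite ?inE ?eqxx ?orbT //; apply/mapP; exists p.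
by case/orP => /mE //=; rewrite andbC.
Qed.

Lemma edge_sym E x y : edge E x y = edge E y x.
Proof. by rewrite /edge orbC. Qed.

Lemma edge_cons a b E x y : edge ((a, b) :: E) x y ->
  [\/ x = a /\ y = b, x = b /\ y = a | edge E x y].
Proof.
rewrite /edge !inE !xpair_eqE.
case/orP => /orP [/andP [/eqP -> /eqP ->]|h]; [exact: Or31|apply: Or33|exact: Or32|apply: Or33];
  by rewrite h ?orbT.
Qed.

Lemma edge_cat E1 E2 x y : edge (E1 ++ E2) x y = edge E1 x y || edge E2 x y.
Proof. by rewrite /edge !mem_cat; do 4!case: (_ \in _). Qed.

Lemma edge_uniq E x y z : uniq (ends E) -> edge E x y -> edge E x z -> y = z.
Proof.
elim: E => [|[a b] E IH] //=; rewrite inE negb_or => /and3P [/andP [ab aE] bE uE].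
case/edge_cons => [[-> ->]|[-> ->]|exy] /edge_cons [[ea ->]|[ea ->]|exz] //.
- by move/mem_ends: exz; rewrite (negPf aE).
- by move/mem_ends: exz; rewrite (negPf bE).
- by move/mem_ends: exy; rewrite ea (negPf aE).
- by move/mem_ends: exy; rewrite ea (negPf bE).
- exact: IH exy exz.
Qed.

Lemma fill_dart_tri n f w N : tri_side n f.2 ->
  fill n (dlab n (dnext f) :: dlab n (dnext (dnext f)) :: w) N ->
  fill n (inv_letter (dlab n f) :: w) N.+1.
Proof. by move=> /rel3_dart r; apply: fill_tri; rewrite inv_letterK. Qed.

Lemma uniq_catl (T : eqType) (s t : seq T) : uniq (s ++ t) -> uniq s.
Proof. by rewrite cat_uniq; case/and3P. Qed.

Lemma uniq_catr (T : eqType) (s t : seq T) : uniq (s ++ t) -> uniq t.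
Proof. by rewrite cat_uniq; case/and3P. Qed.

Lemma uniq_cat_mem (T : eqType) (s t : seq T) x : uniq (s ++ t) -> x \in s -> x \in t -> False.
Proof. by rewrite cat_uniq => /and3P [_ /hasPn h _] xs /h; rewrite /= xs. Qed.

Lemma cat_cons_splitl (T : eqType) (s t u v : seq T) x : uniq (s ++ t) -> x \in s ->
  s ++ t = u ++ x :: v -> exists2 v1, s = u ++ x :: v1 & v = v1 ++ t.
Proof.
move=> us xs /cat_cons_split [[v1 [e1 e2]]|[u2 [_ et]]]; first by exists v1.
by case: (uniq_cat_mem us xs); rewrite et mem_cat inE eqxx orbT.
Qed.

Lemma cat_cons_splitr (T : eqType) (s t u v : seq T) x : uniq (s ++ t) -> x \in t ->
  s ++ t = u ++ x :: v -> exists2 u2, u = s ++ u2 & t = u2 ++ x :: v.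
Proof.
move=> us xt /cat_cons_split [[v1 [es _]]|[u2 [e1 e2]]]; last by exists u2.
by case: (@uniq_cat_mem _ s t x us _ xt); rewrite es mem_cat inE eqxx orbT.
Qed.

Lemma uniq_cat_cons (T : eqType) (x : T) u v s t : uniq (u ++ x :: v) ->
  u ++ x :: v = s ++ x :: t -> u = s /\ v = t.
Proof.
elim: u s => [|y u IH] [|z s] //=.
- by move=> _ [->].
- by case/andP => xv _ [ez ev]; rewrite ev mem_cat inE eqxx orbT in xv.
- by case/andP => yu _ [ey _]; rewrite ey mem_cat inE eqxx orbT in yu.
- by case/andP => _ us [-> /(IH _ us) [-> ->]].
Qed.

Lemma uniq_tri_step (d f : dart) P T : uniq (d :: P ++ tris (f :: T)) ->
  (f \notin [:: dnext f, dnext (dnext f) & P] ++ tris T) &&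
  uniq ([:: dnext f, dnext (dnext f) & P] ++ tris T).
Proof.
have -> : uniq (d :: P ++ tris (f :: T)) =
    uniq [:: d, f & [:: dnext f, dnext (dnext f) & P] ++ tris T].
  by apply: perm_uniq; apply/permP => Q; rewrite /tris /= !count_cat /=; lia.
by rewrite 2!cons_uniq => /and3P [_ -> ->].
Qed.

Lemma uniq_pair_step (d d' : dart) U V T1 T2 : uniq (d :: (U ++ d' :: V) ++ tris (T1 ++ T2)) ->
  [/\ uniq (U ++ tris T1), uniq (V ++ tris T2) & uniq ((U ++ tris T1) ++ (V ++ tris T2))].
Proof.
have -> : uniq (d :: (U ++ d' :: V) ++ tris (T1 ++ T2)) =
    uniq [:: d, d' & (U ++ tris T1) ++ (V ++ tris T2)].
  apply: perm_uniq; apply/permP => Q.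
  by rewrite /tris map_cat flatten_cat /=; do ?rewrite count_cat /=; lia.
rewrite 2!cons_uniq => /and3P [_ _ h]; split=> //; move: h; rewrite cat_uniq; by case/and3P.
Qed.

Lemma diag_uniq_ends n h s L E T : diag n h s L E T -> uniq (pend s ++ tris T) -> uniq (ends E).
Proof. by move=> /diag_ends /perm_uniq ->. Qed.

Lemma mem_diag_ends n h s L E T x y : diag n h s L E T -> edge E x y ->
  (x \in pend s ++ tris T) && (y \in pend s ++ tris T).
Proof. by move=> /diag_ends /perm_mem pE /mem_ends; rewrite !pE. Qed.

(** Planarity: a glued pair anywhere on the boundary separates the diagram into two fillings, not
    only a pair met first by the peeling. *)
Lemma diag_edge_fill n h s L E T p1 d p2 d' p3 : diag n h s L E T ->
  uniq (pend s ++ tris T) -> pend s = p1 ++ d :: p2 ++ d' :: p3 -> edge E d d' ->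
  exists N1 N2, [/\ fill n (map (dlab n) p2) N1, fill n (map (dlab n) (p3 ++ p1)) N2
    & N1 + N2 = size T].
Proof.
move=> D; elim: D p1 p3 => {h s L E T} [h|h d0 g s L E T f tf lf D IH|
    h d0 g u d0' g' v L1 L2 E1 E2 T1 T2 ll D1 IH1 D2 IH2] p1 p3 uT es ed.
- by [].
- have uE := diag_uniq_ends (diag_tri tf lf D) uT.
  have ufE : edge ((d0, f) :: E) d0 f by rewrite /edge inE eqxx.
  have fs : f \notin pend ((d0, g) :: s).
    apply/negP => hf; case: (uniq_cat_mem uT hf).
    by rewrite /tris /= !inE eqxx.
  have d's : d' \in pend ((d0, g) :: s) by rewrite es !(mem_cat, inE) eqxx !orbT.
  case: p1 es => [|x p1] /= [e0 es].
    by subst d; move: fs; rewrite (edge_uniq uE ufE ed) d's.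
  subst x.
  have {}ed : edge E d d'.
    case/edge_cons: ed => [[e1 e2]|[e1 e2]|//].
      by rewrite -e2 d's in fs.
    by move: fs; rewrite -e1 /= es inE !mem_cat inE eqxx !orbT.
  have [||N1 [N2 [f1 f2 sT]]] := IH (dnext f :: dnext (dnext f) :: p1) p3 _ _ ed.
  + by case/andP: (uniq_tri_step uT).
  + by rewrite /= es.
  exists N1, N2.+1; split=> //; last by rewrite addnS sT.
  move: f2; rewrite !map_cat /= => /fill_rot /= f2.
  apply: fill_rot => /=; rewrite -[dlab n d0]inv_letterK -lf.
  exact: fill_dart_tri.
- have uE := diag_uniq_ends (diag_pair ll D1 D2) uT.
  have e0E : edge ((d0, d0') :: E1 ++ E2) d0 d0' by rewrite /edge inE eqxx.
  move: uT es; rewrite [pend _]/= /pend map_cat /= -/(pend u) -/(pend v) => uT es.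
  have [uT1 uT2 uT12] := uniq_pair_step uT.
  have us : uniq (d0 :: pend u ++ d0' :: pend v).
    have : uniq ((d0 :: pend u ++ d0' :: pend v) ++ tris (T1 ++ T2)) by [].
    by rewrite cat_uniq => /and3P [].
  case: p1 es => [|x p1] [e0 es].
    subst d; have ed' := edge_uniq uE e0E ed; subst d'.
    have [eu ev] : pend u = p2 /\ pend v = p3.
      by apply: uniq_cat_cons es; case/andP: us.
    exists (size T1), (size T2); rewrite cats0 -eu -ev size_cat; split=> //.
      exact: diag_fill D1.
    exact: diag_fill D2.
  subst x.
  have nd0 : (d0 \notin p1) && (d != d0) && (d' != d0).
    case/andP: us; rewrite es !(mem_cat, inE) !negb_or => /and5P [-> h1 _ h2 _] _.
    by rewrite !(eq_sym _ d0) h1 h2.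
  have {}ed : edge (E1 ++ E2) d d'.
    case/edge_cons: ed nd0 => [[-> _]|[_ ->]|//]; by rewrite eqxx ?andbF.
  have up : uniq (pend u ++ d0' :: pend v) by case/andP: us.
  have dP x : x \in p1 ++ d :: p2 ++ d' :: p3 -> x \in tris T1 \/ x \in tris T2 -> False.
    rewrite -es => xp xT; apply: (@uniq_cat_mem _ (d0 :: pend u ++ d0' :: pend v) _ x uT).
      by rewrite inE xp orbT.
    by rewrite /tris map_cat flatten_cat mem_cat; case: xT => ->; rewrite ?orbT.
  have dp : d \in p1 ++ d :: p2 ++ d' :: p3 by rewrite !(mem_cat, inE) eqxx !orbT.
  have d'p : d' \in p1 ++ d :: p2 ++ d' :: p3 by rewrite !(mem_cat, inE) eqxx !orbT.
  move: ed; rewrite edge_cat => /orP [ed|ed].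
    have [du d'u] : d \in pend u /\ d' \in pend u.
      case/andP: (mem_diag_ends D1 ed); rewrite !mem_cat => /orP [h1|h1] /orP [h2|h2] //.
      - by case: (dP _ d'p); left.
      - by case: (dP _ dp); left.
      - by case: (dP _ dp); left.
    have [w eu ew] := cat_cons_splitl up du es.
    have upw : uniq (w ++ d0' :: pend v).
      have := up; have -> : pend u ++ d0' :: pend v = rcons p1 d ++ (w ++ d0' :: pend v).
        by rewrite eu cat_rcons -catA.
      exact: uniq_catr.
    have d'w : d' \in w.
      move: d'u up; rewrite es eu mem_cat inE => /or3P [h1|/eqP h1|//].
        by rewrite cat_uniq => /and3P [_ /hasPn /(_ d') + _]; rewrite !(mem_cat, inE) eqxx !orbT /= h1 => /(_ isT).
      by rewrite cat_uniq /= h1 !(mem_cat, inE) eqxx !orbT !andbF.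
    have [w' ew' ep3] := cat_cons_splitl upw d'w (esym ew).
    subst w; have [N1 [N2 [f1 f2 eN]]] := IH1 _ _ uT1 eu ed.
    exists N1, (N2 + size T2); split => //; last by rewrite size_cat addnA eN.
    rewrite ep3 map_cat; apply: fill_rot; rewrite -map_cat cat_cons catA /= map_cat /= ll.
    apply: fill_pair (diag_fill D2).
    by rewrite map_cat; apply: fill_rot; rewrite -map_cat.
  have [dv d'v] : d \in pend v /\ d' \in pend v.
    case/andP: (mem_diag_ends D2 ed); rewrite !mem_cat => /orP [h1|h1] /orP [h2|h2] //.
    - by case: (dP _ d'p); right.
    - by case: (dP _ dp); right.
    - by case: (dP _ dp); right.
  rewrite -cat_rcons in es up.
  have [w ep1 ev] := cat_cons_splitr up dv es.
  have [N1 [N2 [f1 f2 eN]]] := IH2 _ _ uT2 ev ed.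
  exists N1, (size T1 + N2); split => //; last by rewrite size_cat addnCA eN.
  rewrite map_cat; apply: fill_rot; rewrite -map_cat ep1 cat_rcons cat_cons -catA.
  rewrite cat_cons /= map_cat /= ll; apply: fill_pair (diag_fill D1) _.
  by rewrite map_cat; apply: fill_rot; rewrite -map_cat.
Qed.

(** A diagram can be peeled at any boundary edge. If [f] is another side of the triangle peeled
    first, then [d] is afterwards glued to a boundary edge and [diag_edge_fill] cuts the diagram
    there. *)
Lemma diag_edge_tri n h s L E T p1 d p2 f : diag n h s L E T ->
  uniq (pend s ++ tris T) -> pend s = p1 ++ d :: p2 -> edge E d f -> f \in tris T ->
  fill n (map (dlab n) (p1 ++ [:: dnext f, dnext (dnext f) & p2])) (size T).-1.
Proof.
move=> D; elim: D p1 p2 => {h s L E T} [h|h d0 g s L E T f0 tf lf D IH|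
    h d0 g u d0' g' v L1 L2 E1 E2 T1 T2 ll D1 IH1 D2 IH2] p1 p2 uT es ed fT.
- by [].
- have uE := diag_uniq_ends (diag_tri tf lf D) uT.
  have ufE : edge ((d0, f0) :: E) d0 f0 by rewrite /edge inE eqxx.
  case: p1 es => [|x p1] /= [e0 es].
    subst d; rewrite -(edge_uniq uE ufE ed) -es.
    exact: diag_fill D.
  subst x.
  have /andP [f0s us] := uniq_tri_step uT.
  have ds : d \in pend ((d0, g) :: s) by rewrite /= es !(mem_cat, inE) eqxx !orbT.
  have {}ed : edge E d f.
    case/edge_cons: ed => [[e1 e2]|[e1 e2]|//].
      have : uniq (pend ((d0, g) :: s)) by move: uT; rewrite cat_uniq => /and3P [].
      by rewrite /= es -e1 mem_cat inE eqxx orbT.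
    by case: (uniq_cat_mem uT ds); rewrite e1 /tris /= inE eqxx.
  have t3 w N : fill n (dlab n (dnext f0) :: dlab n (dnext (dnext f0)) :: w) N -> fill n (dlab n d0 :: w) N.+1.
    by rewrite -[dlab n d0]inv_letterK -lf; exact: fill_dart_tri.
  have esub : pend [:: (dnext f0, [::]), (dnext (dnext f0), f0 :: g) & s] =
     [:: dnext f0, dnext (dnext f0) & p1] ++ d :: p2 by rewrite /= es.
  have f0K : dnext (dnext (dnext f0)) = f0.
    by move: tf; case: (f0) => m x /andP [_ h3]; rewrite /dnext /= side_nextK.
  move: fT; rewrite [tris _]/= !inE => /or4P [/eqP ef|/eqP ef|/eqP ef|fT].
  + by case/andP: (mem_diag_ends D ed) => _; rewrite ef (negPf f0s).
  + subst f; rewrite edge_sym in ed.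
    have [N1 [N2 [f1 f2 eN]]] := @diag_edge_fill _ _ _ _ _ _ [::] _ (dnext (dnext f0) :: p1) _ _ D us esub ed.
    apply: (@fill_eq _ (dlab n d0 :: map (dlab n) (p1 ++ [:: dnext (dnext f0)]) ++
        inv_letter (dlab n d0) :: map (dlab n) p2)); last first.
      by rewrite f0K -lf /= !map_cat /= -catA.
        rewrite -eN; rewrite cats0 in f2; apply: fill_pair f2.
    rewrite map_cat; exact: (@fill_rot n [:: dlab n (dnext (dnext f0))] (map (dlab n) p1) N1 f1).
  + subst f; rewrite edge_sym in ed.
    have [N1 [N2 [f1 f2 eN]]] := @diag_edge_fill _ _ _ _ _ _ [:: dnext f0] _ p1 _ _ D us esub ed.
    apply: (@fill_eq _ (dlab n d0 :: map (dlab n) p1 ++ inv_letter (dlab n d0) ::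
        map (dlab n) (dnext f0 :: p2))); last by rewrite f0K -lf /= !map_cat.
    rewrite -eN; apply: fill_pair f1 _; rewrite map_cat in f2; exact: (fill_rot f2).
  + have := IH _ _ us esub ed fT.
    have : 0 < size T by case: (T) fT.
    by case: (size T) => //= N _ /t3.
- have uE := diag_uniq_ends (diag_pair ll D1 D2) uT.
  have e0E : edge ((d0, d0') :: E1 ++ E2) d0 d0' by rewrite /edge inE eqxx.
  move: uT es; rewrite [pend _]/= /pend map_cat /= -/(pend u) -/(pend v) => uT es.
  have uT' : uniq ((d0 :: pend u ++ d0' :: pend v) ++ tris (T1 ++ T2)) := uT.
  have fs : f \notin d0 :: pend u ++ d0' :: pend v by apply/negP => /(uniq_cat_mem uT'); apply.
  have [uT1 uT2 _] := uniq_pair_step uT.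
  have us : uniq (d0 :: pend u ++ d0' :: pend v) by exact: (uniq_catl uT').
  case: p1 es => [|x p1] [e0 es].
    subst d; have ef := edge_uniq uE e0E ed.
    by rewrite -ef !(mem_cat, inE) eqxx !orbT in fs.
  subst x.
  have up : uniq (pend u ++ d0' :: pend v) by case/andP: us.
  have {}ed : edge (E1 ++ E2) d f.
    case/edge_cons: ed => [[_ ef]|[_ ef]|//];
      by rewrite ef !(mem_cat, inE) eqxx ?orbT in fs.
  have dT : d \notin tris (T1 ++ T2).
    apply/negP; apply: (uniq_cat_mem uT'); by rewrite es !(mem_cat, inE) eqxx !orbT.
  rewrite {1}/tris map_cat flatten_cat mem_cat negb_or -!/(tris _) in dT.
  rewrite inE mem_cat inE !negb_or in fs.
  case/and4P: fs => _ fu _ fv; case/andP: dT => dT1 dT2.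
  move: ed; rewrite edge_cat => /orP [ed|ed].
    case/andP: (mem_diag_ends D1 ed); rewrite !mem_cat (negPf dT1) (negPf fu) orbF /= => du fT1.
    have [w eu ew] := cat_cons_splitl up du es.
    have := IH1 _ _ uT1 eu ed fT1.
    have : 0 < size T1 by case: (T1) fT1.
    rewrite size_cat; case: (size T1) => //= N _ fN.
    rewrite ew -!cat_cons catA map_cat /= ll; apply: (fill_pair _ fN).
    exact: diag_fill D2.
  case/andP: (mem_diag_ends D2 ed); rewrite !mem_cat (negPf dT2) (negPf fv) orbF /= => dv fT2.
  rewrite -cat_rcons in es up.
  have [w ep1 ev] := cat_cons_splitr up dv es.
  have := IH2 _ _ uT2 ev ed fT2.
  have : 0 < size T2 by case: (T2) fT2.
  rewrite size_cat addnC; case: (size T2) => //= N _ fN.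
  rewrite ep1 cat_rcons -catA cat_cons map_cat /= ll addnC.
  exact: (fill_pair _ (diag_fill D1) fN).
Qed.

(** Two copies of one relator read in opposite directions, at the same place: glued along these
    sides they form a cancelling pair. *)
Definition mirror (x y : dart) : bool :=
  [&& x.2.1.1 == y.2.1.1, x.2.1.2 != y.2.1.2, x.2.2 == y.2.2 & x.2.2 < 3].

Lemma mirror_sym x y : mirror x y = mirror y x.
Proof.
by rewrite /mirror eq_sym (eq_sym x.2.1.2) (eq_sym x.2.2); case: (_ =P x.2.2) => [->|]; rewrite ?andbF.
Qed.

Lemma mirror_lab n x y : mirror x y ->
  dlab n (dnext (dnext y)) = inv_letter (dlab n (dnext x)).
Proof.
case: x y => m [[i o] k] [m' [[i' o'] k']] /and4P [/= /eqP <- ho /eqP <- hk].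
have {ho}-> : o' = ~~ o by move: ho; case: o; case: o'.
by case: k hk => [|[|[|k]]] // _; case: o.
Qed.

(** Once one triangle of the pair is peeled at the boundary, the other is peeled at the common side.
    The word then shows a letter next to its inverse, and folding gives back the former boundary
    without the two triangles. *)
Lemma diag_mirror n h s L E T x y : diag n h s L E T -> uniq (pend s ++ tris T) ->
  edge E x y -> x \in tris T -> y \in tris T -> mirror x y ->
  exists2 N, N < size T & fill n (map (dlab n) (pend s)) N.
Proof.
move=> D; elim: D x y => {h s L E T} [h|h d0 g s L E T f0 tf lf D IH|
    h d0 g u d0' g' v L1 L2 E1 E2 T1 T2 ll D1 IH1 D2 IH2] x y uT exy xT yT mxy.
- by [].
- have /andP [f0s us] := uniq_tri_step uT.
  have xs z : z \in tris (f0 :: T) -> (z == d0) = false.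
    by move=> zT; apply/eqP => ez; apply: (uniq_cat_mem uT _ zT); rewrite ez inE eqxx.
  have {exy}exy : edge E x y.
    case/edge_cons: exy => [[e1 e2]|[e1 e2]|//].
      by move: (xs _ xT); rewrite e1 eqxx.
    by move: (xs _ yT); rewrite e2 eqxx.
  have t3 w N : fill n (dlab n (dnext f0) :: dlab n (dnext (dnext f0)) :: w) N -> fill n (dlab n d0 :: w) N.+1.
    by rewrite -[dlab n d0]inv_letterK -lf; exact: fill_dart_tri.
  have f0E z : edge E f0 z = false.
    by apply/negP => /(mem_diag_ends D); rewrite (negPf f0s).
  have f0K : dnext (dnext (dnext f0)) = f0.
    by move: tf; case: (f0) => m z /andP [_ h3]; rewrite /dnext /= side_nextK.
  have ld : dlab n d0 = inv_letter (dlab n f0) by rewrite lf inv_letterK.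
  have key z t : z \in [:: dnext f0; dnext (dnext f0)] -> t \in tris T -> edge E z t ->
      mirror z t -> exists2 N, N < size (f0 :: T) & fill n (map (dlab n) (pend ((d0, g) :: s))) N.
    move=> zf tT ezt mzt.
    have m1 := mirror_lab n mzt; have m2 : dlab n (dnext t) = inv_letter (dlab n (dnext (dnext z))).
      by rewrite (mirror_lab n (x := t)) ?inv_letterK // mirror_sym.
    move: zf; rewrite !inE => /orP [/eqP ez|/eqP ez]; subst z.
      have := diag_edge_tri (p1 := [::]) D us erefl ezt tT.
      rewrite /= m1 m2 f0K -ld => fN.
      have [M hM fM] := @fill_fold_at n [:: dlab n d0] (map (dlab n) (pend s)) (inv_letter (dlab n (dnext (dnext f0)))) _
         (fill_eq fN (congr1 (fun a => [:: dlab n d0, _, a & _]) (esym (inv_letterK _)))).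
      by exists M => //; rewrite ltnS (leq_trans hM) ?leq_pred.
    have := diag_edge_tri (p1 := [:: dnext f0]) D us erefl ezt tT.
    rewrite /= m1 m2 f0K -ld => fN.
    have [M hM fM] := @fill_fold_at n [::] (dlab n d0 :: map (dlab n) (pend s)) (dlab n (dnext f0)) _ fN.
    by exists M => //; rewrite ltnS (leq_trans hM) ?leq_pred.
  have ftri z : z \in tris (f0 :: T) -> [|| z == f0, z \in [:: dnext f0; dnext (dnext f0)] | z \in tris T].
    by rewrite /tris /= !inE -!orbA.
  case/or3P: (ftri _ xT) => [/eqP ex|xf|xT']; first by rewrite ex f0E in exy.
    case/or3P: (ftri _ yT) => [/eqP ey|yf|yT']; first by rewrite edge_sym ey f0E in exy.
      case/and4P: mxy => _ hxy _ _; case/negP: hxy; move: xf yf; rewrite !inE.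
      by case/orP => /eqP ->; case/orP => /eqP ->; case: (f0) => m [[i o] k].
    exact: key xf yT' exy mxy.
  case/or3P: (ftri _ yT) => [/eqP ey|yf|yT']; first by rewrite edge_sym ey f0E in exy.
    by apply: (key y x yf xT'); [rewrite edge_sym | rewrite mirror_sym].
  have [N hN /= fN] := IH _ _ us exy xT' yT' mxy.
  by exists N.+1 => //; exact: t3.
- move: uT; rewrite [pend _]/= /pend map_cat /= -/(pend u) -/(pend v) => uT.
  have [uT1 uT2 _] := uniq_pair_step uT.
  have uT' : uniq ((d0 :: pend u ++ d0' :: pend v) ++ tris (T1 ++ T2)) := uT.
  have nT z : z \in tris (T1 ++ T2) -> z \notin d0 :: pend u ++ d0' :: pend v.
    by move=> zT; apply/negP => /(uniq_cat_mem uT'); apply.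
  have {exy}exy : edge (E1 ++ E2) x y.
    case/edge_cons: exy => [[ex _]|[_ ey]|//].
      by move: (nT _ xT); rewrite ex inE eqxx.
    by move: (nT _ yT); rewrite ey inE eqxx.
  have := nT _ xT; rewrite inE mem_cat inE !negb_or => /and4P [_ xu _ xv].
  have := nT _ yT; rewrite inE mem_cat inE !negb_or => /and4P [_ yu _ yv].
  move: exy; rewrite edge_cat => /orP [exy|exy].
    case/andP: (mem_diag_ends D1 exy); rewrite !mem_cat (negPf xu) (negPf yu) /= => xT1 yT1.
    have [N hN fN] := IH1 _ _ uT1 exy xT1 yT1 mxy.
    exists (N + size T2); first by rewrite size_cat ltn_add2r.
    by rewrite map_cat /= ll; exact: fill_pair fN (diag_fill D2).
  case/andP: (mem_diag_ends D2 exy); rewrite !mem_cat (negPf xv) (negPf yv) /= => xT2 yT2.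
  have [N hN fN] := IH2 _ _ uT2 exy xT2 yT2 mxy.
  exists (size T1 + N); first by rewrite size_cat ltn_add2l.
  by rewrite map_cat /= ll; exact: fill_pair (diag_fill D1) fN.
Qed.

(** * Discharging *)

(* The kind [((o, k), k')] of a dart [(_, (i, o, k))] glued to a dart at place
   [k'] of its relator; up to a shift of the indices it determines the corner
   which follows in the rotation around the origin. *)
Definition kind := (bool * nat * nat)%type.

(** The same edge seen from its other side. Glued letters are inverse and place [2] carries the
    inverse generator, so the two places and one orientation fix the other orientation. *)
Definition kind_flip (c : kind) : kind :=
  let: (o, k, k') := c in (~~ ((k == 2) (+) o) (+) (k' == 2), k', k).
Definition kind_step (c : kind) : bool * nat :=
  let: (o, k, _) := kind_flip c in (o, next_place o k).
Definition kind_ok (c : kind) : bool := [&& c.1.2 < 3, c.2 < 3 & c.1.2 != c.2].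

(** This partial map consists of two 5-cycles, which are the kinds met around a vertex of degree
    five ([walk_check5]). Hence one kind there determines the other four. *)
Definition penta_next (c : kind) : option kind :=
  match c with
  | (false, 0, 1) => Some (true, 0, 2)
  | (true, 0, 2) => Some (true, 1, 0)
  | (true, 1, 0) => Some (false, 1, 2)
  | (false, 1, 2) => Some (false, 0, 2)
  | (false, 0, 2) => Some (false, 0, 1)
  | (false, 1, 0) => Some (true, 2, 0)
  | (true, 2, 0) => Some (true, 2, 1)
  | (true, 2, 1) => Some (true, 0, 1)
  | (true, 0, 1) => Some (false, 2, 0)
  | (false, 2, 0) => Some (false, 1, 0)
  | _ => None
  end.

(* Angles at a vertex of degree five, in units where a triangle has angle sum
   [120]. Equal angles [48] would leave flat vertices of degree eight. *)
Definition penta_angle (c : kind) : nat :=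
  match c with
  | (false, 1, 2) | (true, 0, 1) => 50
  | (true, 0, 2) | (false, 1, 0) => 46
  | (true, 1, 0) | (false, 0, 2) | (false, 0, 1)
  | (false, 2, 0) | (true, 2, 0) | (true, 2, 1) => 48
  | _ => 0
  end.

(* Angle left at a corner by the other two corners of its triangle, which are
   given by their kinds if they lie at vertices of degree five. *)
Definition rest_angle (a b : option kind) : nat :=
  match a, b with
  | Some a, Some b => 120 - penta_angle a - penta_angle b
  | Some a, None | None, Some a => (120 - penta_angle a) %/ 2
  | None, None => 40
  end.

(* In [(c, b)] the flag [b] tells whether the edge leads to a vertex of degree five. *)
Definition flag_compat (p q : kind * bool) : bool :=
  let c := kind_flip p.1 in let d := penta_next (kind_flip q.1) in
  [&& q.2 ==> d, p.2 ==> penta_next c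
    & p.2 && q.2 ==> (obind (fun d => penta_next (kind_flip d)) d == Some c)].

Definition flag_angle (p q : kind * bool) : nat :=
  rest_angle (if q.2 then penta_next (kind_flip q.1) else None)
             (if p.2 then Some (kind_flip p.1) else None).

Fixpoint path_sum (T : Type) (f : T -> T -> nat) x (l : seq T) : nat :=
  if l is y :: l' then f x y + path_sum f y l' else 0.

(** * Enumeration of the closed paths in the vertex link *)

Definition place_shift (k : nat) : nat := nth 0 [:: 0; 3; 1] k.

(** Crossing an edge changes the relator index by the difference of the two place shifts modulo [n].
    After a full turn the sum [d] of these differences is, up to sign, a multiple of [n]; the
    condition keeps every [d] that is possible for some admissible [n]. *)
Definition shift_ok (l : seq kind) : bool :=
  let a := sumn [seq place_shift c.1.2 | c <- l] in
  let b := sumn [seq place_shift c.2 | c <- l] in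
  let d := (a - b) + (b - a) in
  (d == 0) || [&& 11 <= d, d != 12 & d != 14].

Definition kinds_of (t : bool * nat) : seq kind := [seq (t, k) | k <- iota 0 3 & t.2 != k].

Fixpoint walks r (t : bool * nat) : seq (seq kind) :=
  if r is r'.+1 then
    flatten [seq [seq c :: l | l <- walks r' (kind_step c)]
            | c <- kinds_of t]
  else [:: [::]].

Definition start_types := [seq (o, k) | o <- [:: false; true], k <- iota 0 3].

Definition closed_walk (t : bool * nat) (l : seq kind) : bool :=
  (kind_step (last (t, 0) l) == t) && shift_ok l.

Definition walk_check (r : nat) (P : seq kind -> bool) : bool :=
  all (fun t => all (fun l => if closed_walk t l then P l else true) (walks r t)) start_types.

Definition penta_check (l : seq kind) : bool :=
  cycle (fun c d => penta_next c == Some d) l && (sumn (map penta_angle l) == 240).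

(** All compatible flags along the path are tried. Angles are integers and a full turn is [240], so
    [241] expresses strictly negative curvature. *)
Fixpoint flag_check (p0 p : kind * bool) (l : seq kind) (acc : nat) : bool :=
  if l is c :: l' then
    all (fun b => if flag_compat p (c, b)
                  then flag_check p0 (c, b) l' (acc + flag_angle p (c, b)) else true)
        [:: false; true]
  else if flag_compat p p0 then 241 <= acc + flag_angle p p0 else true.

Definition angle_check (l : seq kind) : bool :=
  if l is c :: l' then all (fun b => flag_check (c, b) (c, b) l' 0) [:: false; true]
  else true.

Lemma walk_check5 : walk_check 5 penta_check.
Proof. by vm_cast_no_check (erefl true). Qed.

Lemma walk_check_le10 : all (fun r => walk_check r angle_check) [:: 1; 2; 3; 4; 6; 7; 8; 9; 10].
Proof. by vm_cast_no_check (erefl true). Qed.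

Definition all_kinds : seq kind := [seq (t, k) | t <- start_types, k <- iota 0 3].

(** The value [20], left by two angles [50], does not occur. This matters because [22 * 11 = 242]
    settles every degree from eleven on, whereas [20 * 11] falls short of the full turn. *)
Lemma flag_angle_ge22 : all (fun p => all (fun q => flag_compat p q && (kind_step p.1 == q.1.1) ==> (22 <= flag_angle p q))
   [seq (c, b) | c <- all_kinds, b <- [:: false; true]]) [seq (c, b) | c <- all_kinds, b <- [:: false; true]].
Proof. by vm_cast_no_check (erefl true). Qed.

Lemma no_penta_triangle : all (fun c =>
   if penta_next (kind_flip c) is Some d then
     if penta_next (kind_flip d) is Some d' then penta_next (kind_flip d') != Some c else true
   else true) all_kinds.
Proof. by vm_cast_no_check (erefl true). Qed.

Lemma flag_checkP p0 p lb acc : path flag_compat p (rcons lb p0) ->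
  flag_check p0 p (map fst lb) acc -> 241 <= acc + path_sum flag_angle p (rcons lb p0).
Proof.
elim: lb p acc => [|[c b] lb IH] p acc /=; first by rewrite andbT addn0 => ->.
case/andP => cpq hp /and3P [h1 h2 _]; rewrite addnA; apply: IH hp _.
by case: b cpq h1 h2 => -> //.
Qed.

Lemma angle_checkP x l : cycle flag_compat (x :: l) -> angle_check (map fst (x :: l)) ->
  241 <= path_sum flag_angle x (rcons l x).
Proof.
case: x => c b /= hc /and3P [h1 h2 _]; rewrite -[path_sum _ _ _]add0n.
by apply: flag_checkP => //; case: b {hc}.
Qed.

Lemma mem_kinds_of c : kind_ok c -> c \in kinds_of c.1.
Proof. by case: c => [[[] [|[|[|k]]]] [|[|[|k']]]]. Qed.

Lemma mem_walks c l : all kind_ok (c :: l) -> path (fun c d => kind_step c == d.1) c l ->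
  c :: l \in walks (size l).+1 c.1.
Proof.
elim: l c => [|d l IH] c; rewrite [all _ _]/= => /andP [okc okl].
  move=> _; apply/flattenP; exists [:: [:: c]]; last by rewrite inE.
  by apply/mapP; exists c => //; exact: mem_kinds_of.
case/andP => /eqP e hp; apply/flattenP.
exists [seq c :: l | l <- walks (size l).+1 (kind_step c)].
  by apply/mapP; exists c => //; exact: mem_kinds_of.
by apply: map_f; rewrite e; exact: IH.
Qed.

Lemma walk_checkP P c l : walk_check (size l).+1 P -> all kind_ok (c :: l) ->
  cycle (fun c d => kind_step c == d.1) (c :: l) -> shift_ok (c :: l) -> P (c :: l).
Proof.
move=> ck ok /= hc sh; rewrite rcons_path in hc; case/andP: hc => hp hl.
have ct : c.1 \in start_types.
  by case/andP: ok => + _; case: (c) => [[[] [|[|[|k]]]] [|[|[|k']]]].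
move/allP: ck => /(_ _ ct) /allP /(_ _ (mem_walks ok hp)).
by rewrite /closed_walk sh [last _ _]/= hl.
Qed.

Lemma kind_okP c : kind_ok c -> c \in all_kinds.
Proof. by case: c => [[[] [|[|[|k]]]] [|[|[|k']]]]. Qed.

Lemma penta_angle_le c : penta_angle c <= 50.
Proof. by case: c => [[[] [|[|[|k]]]] [|[|[|k']]]]. Qed.

(** * Discharging on a reduced planar map given by its darts *)

Section Discharge.

Variables (n : nat) (L : seq (seq dart)) (B T : seq dart) (e next_ : dart -> dart).
Hypothesis n_ge11 : 11 <= n.
Hypothesis n_neq12 : n != 12.
Hypothesis n_neq14 : n != 14.
Hypothesis uniqL : uniq (flatten L).
Hypothesis permL : perm_eq (flatten L) (B ++ tris T).
Hypothesis eK : involutive e.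
Hypothesis eL : {in flatten L, forall x, e x \in flatten L}.
Hypothesis e_lab : {in flatten L, forall x, dlab n (e x) = inv_letter (dlab n x)}.
Hypothesis cycleL : {in L, forall l, (l != [::]) && cycle (fun x y => y == next_ (e x)) l}.
Hypothesis next_tri : {in tris T, forall x, next_ x = dnext x}.
Hypothesis next_bd : {in B, forall x, next_ x \in B}.
Hypothesis side_bd : {in B, forall x, 3 <= x.2.2}.
Hypothesis side_tri : all (fun f => tri_side n f.2) T.
Hypothesis reduced : {in tris T, forall x, e x \in tris T -> ~~ mirror x (e x)}.
Hypothesis euler : 2 * size L = size B + size T + 2.

Let isT (x : dart) := x.2.2 < 3.
Let rot_ x := next_ (e x).
Let kind_of x : kind := (x.2.1.2, x.2.2, (e x).2.2).
Let five_leaf l := all isT l && (size l == 5).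
Let five x := has (fun l => five_leaf l && (x \in l)) L.

Lemma tris_side x : x \in tris T -> tri_side n x.2.
Proof.
case/flattenP => t /mapP [f /(allP side_tri) hf ->]; rewrite !inE.
by case/or3P => /eqP -> //; do ?apply: tri_side_next.
Qed.

Lemma mem_L x : x \in flatten L = (x \in B) || (x \in tris T).
Proof. by rewrite (perm_mem permL) mem_cat. Qed.

Lemma isT_L x : x \in flatten L -> isT x = (x \in tris T).
Proof.
rewrite mem_L; case: (boolP (x \in tris T)) => [/tris_side /andP [_ h] _|_].
  by rewrite /isT h.
by rewrite orbF => /side_bd; rewrite /isT leqNgt => /negPf.
Qed.

Lemma dnextK x : x \in tris T -> dnext (dnext (dnext x)) = x.
Proof. by move/tris_side; case: x => m x /andP [_ h]; rewrite /dnext /= side_nextK. Qed.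

Lemma tris_dnext x : x \in tris T -> dnext x \in tris T.
Proof.
case/flattenP => t /mapP [f fT ->] xf; apply/flattenP; exists (tri_darts f); first exact: map_f.
have fK : dnext (dnext (dnext f)) = f.
  by apply: dnextK; apply/flattenP; exists (tri_darts f); rewrite ?inE ?eqxx //; apply: map_f.
by move: xf; rewrite !inE => /or3P [] /eqP ->; rewrite ?fK eqxx ?orbT.
Qed.

Lemma rot_leaf l x : l \in L -> x \in l -> rot_ x \in l.
Proof.
move=> lL xl; case/andP: (cycleL lL) => _ /next_cycle /(_ xl) /eqP h.
by rewrite /rot_ -h mem_next.
Qed.

Lemma leaf_uniq l l' x : l \in L -> l' \in L -> x \in l -> x \in l' -> l = l'.
Proof.
move: uniqL; elim: L => //= m M IH; rewrite cat_uniq => /and3P [_ /hasPn hM uM].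
have out k : k \in M -> x \in k -> x \notin m by move=> kM xk; apply: hM; apply/flattenP; exists k.
rewrite !inE => /predU1P [->|lM] /predU1P [->|l'M] // xl xl'.
- by move: (out _ l'M xl'); rewrite xl.
- by move: (out _ lM xl); rewrite xl'.
- exact: IH.
Qed.

Lemma five_leafE l x : l \in L -> x \in l -> five x = five_leaf l.
Proof.
move=> lL xl; apply/hasP/idP => [[l' l'L /andP [h xl']]|h].
  by rewrite (leaf_uniq lL l'L xl xl').
by exists l; rewrite ?h.
Qed.

Lemma five_rot x : x \in flatten L -> five (rot_ x) = five x.
Proof.
by case/flattenP => l lL xl; rewrite (five_leafE lL xl) (five_leafE lL (rot_leaf lL xl)).
Qed.

Lemma fiveP x : five x -> exists l, [/\ l \in L, x \in l, all isT l & size l = 5].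
Proof. by case/hasP => l lL /andP [/andP [h /eqP s] xl]; exists l. Qed.

Lemma leaf_L l x : l \in L -> x \in l -> x \in flatten L.
Proof. by move=> lL xl; apply/flattenP; exists l. Qed.

(** If [e x] lay on the outer face, so would the next corner [next_ (e x)] of the same vertex. *)
Lemma leaf_tris l x : l \in L -> all isT l -> x \in l -> (x \in tris T) && (e x \in tris T).
Proof.
move=> lL aT xl; have xL := leaf_L lL xl.
rewrite -(isT_L xL) (allP aT _ xl) /=.
have := eL xL; rewrite mem_L => /orP [/next_bd/side_bd|//].
by have := allP aT _ (rot_leaf lL xl); rewrite /isT /rot_ ltnNge => /negPf ->.
Qed.

Lemma five_tris x : five x -> (x \in tris T) && (e x \in tris T).
Proof. by case/fiveP => l [lL xl aT _]; exact: leaf_tris aT xl. Qed.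

Lemma side_lab_shift x : tri_side n x ->
  side_lab n x = ((x.1.1 + place_shift x.2) %% n, (x.2 == 2) (+) x.1.2).
Proof.
case: x => [[i o] [|[|[|k]]]] /andP [//= hi _].
by rewrite addn0 modn_small.
Qed.

Lemma glued_sides x : x \in tris T -> e x \in tris T ->
  (e x).2.1.1 + place_shift (e x).2.2 = x.2.1.1 + place_shift x.2.2 %[mod n] /\
  ((e x).2.2 == 2) (+) (e x).2.1.2 = ~~ ((x.2.2 == 2) (+) x.2.1.2).
Proof.
move=> xT exT; have xL : x \in flatten L by rewrite mem_L xT orbT.
have := e_lab xL; rewrite /dlab (side_lab_shift (tris_side xT)) (side_lab_shift (tris_side exT)).
by case.
Qed.

Lemma kind_of_flip x : x \in tris T -> e x \in tris T -> kind_of (e x) = kind_flip (kind_of x).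
Proof.
move=> xT exT; have [_] := glued_sides xT exT.
by rewrite /kind_of /= eK => <-; case: (_ == 2); case: (_.2.1.2).
Qed.

Lemma kind_of_step x : x \in tris T -> e x \in tris T -> kind_step (kind_of x) = (kind_of (rot_ x)).1.
Proof.
move=> xT exT; rewrite /kind_step -(kind_of_flip xT exT) /kind_of /rot_ (next_tri exT).
by case: (e x) => m [[i o] k].
Qed.

(** Inverse labels at equal places force equal indices and opposite orientations, that is, a mirror
    pair. *)
Lemma kind_of_ok x : x \in tris T -> e x \in tris T -> kind_ok (kind_of x).
Proof.
move=> xT exT; have [h1 h2] := glued_sides xT exT.
have /andP [hi hk] := tris_side xT; have /andP [hi' hk'] := tris_side exT.
rewrite /kind_ok /= hk hk' /=; apply/negP => /eqP ek.
have /negP := reduced xT exT; apply; rewrite /mirror -ek eqxx hk !andbT.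
apply/andP; split.
  move/eqP: h1; rewrite -ek eqn_modDr !modn_small // => /eqP ->; exact: eqxx.
by move: h2; rewrite -ek; case: (_ == 2); case: (x.2.1.2); case: ((e x).2.1.2).
Qed.

Lemma cycle_map_rot (f : dart -> dart) l : cycle (fun x y => y == f x) l -> map f l = rot 1 l.
Proof.
case: l => //= x l; rewrite rot1_cons.
have : path (fun x y => y == f x) x (rcons l x) -> f x :: map f l = rcons l x.
  move: {2 4}x => z; elim: l x => [|y l IH] x /=; first by rewrite andbT => /eqP ->.
  by case/andP => /eqP -> /IH ->.
by apply.
Qed.

Lemma leaf_shift l : l \in L -> all isT l -> shift_ok (map kind_of l).
Proof.
move=> lL aT; rewrite /shift_ok -!map_comp.
set a := sumn _; set b := sumn _.
have ab : a = b %[mod n].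
  (* The rotation permutes [l], and [next_] stays in the same triangle, so the indices cancel from
     the sum of the gluing congruences and only the place shifts remain. *)
  have ci : sumn [seq (e x).2.1.1 | x <- l] = sumn [seq x.2.1.1 | x <- l].
    have : perm_eq (map rot_ l) l.
      rewrite (cycle_map_rot (f := rot_)); last by case/andP: (cycleL lL).
      by rewrite perm_rot.
    move=> /(perm_map (fun x : dart => x.2.1.1)) /perm_sumn <-; rewrite -map_comp; congr sumn.
    apply/eq_in_map => x xl /=; have /andP [_ exT] := leaf_tris lL aT xl.
    by rewrite /rot_ (next_tri exT); case: (e x) => m [[i o] k].
  have : sumn [seq (e x).2.1.1 + place_shift (e x).2.2 | x <- l] =
         sumn [seq x.2.1.1 + place_shift x.2.2 | x <- l] %[mod n].
    have : {subset l <= l} by [].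
    move: {1 3 4}l; elim=> [//|x s IH] sl /=.
    have /andP [xT exT] : (x \in tris T) && (e x \in tris T).
      by apply: (leaf_tris lL aT); apply: sl; rewrite inE eqxx.
    have [h _] := glued_sides xT exT.
    rewrite -modnDm h IH ?modnDm // => y ys; apply: sl; by rewrite inE ys orbT.
  have sD (f g : dart -> nat) : sumn [seq f x + g x | x <- l] = sumn (map f l) + sumn (map g l).
    by elim: (l) => //= x s ->; rewrite addnACA.
  by rewrite !sD ci => /eqP; rewrite eqn_modDl => /eqP.
have : n %| (a - b) + (b - a).
  have [h|h] := leqP a b.
    by move/eqP: ab; rewrite (eqP (_ : a - b == 0)) ?subn_eq0 // eq_sym eqn_mod_dvd.
  by move/eqP: ab; rewrite (eqP (_ : b - a == 0)) ?subn_eq0 1?ltnW // addn0 eqn_mod_dvd // ltnW.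
set d := (a - b) + _; case: (posnP d) => [-> //|d0] nd.
apply/orP; right; rewrite (leq_trans n_ge11 (dvdn_leq d0 nd)) /=; apply/andP; split.
  apply/eqP => d12; move: nd; rewrite d12 => nd; have n12 : n <= 12 by exact: dvdn_leq nd.
  have : n = 11 by move: n_ge11 n_neq12; lia.
  by move=> n11; rewrite n11 in nd.
apply/eqP => d14; move: nd; rewrite d14 => nd; have n14 : n <= 14 by exact: dvdn_leq nd.
have : [|| n == 11, n == 12 | n == 13] by move: n_ge11 n_neq14; lia.
by case/or3P => /eqP en; rewrite en in nd.
Qed.

Lemma leaf_cycle (U : eqType) (f : dart -> U) (R : rel U) l : l \in L ->
  {in l, forall x, R (f x) (f (rot_ x))} -> cycle R (map f l).
Proof.
move=> lL h; have /andP [_ hc] := cycleL lL.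
apply: (homo_cycle_in (P := mem l) _ _ hc); last by apply/allP.
by move=> x y xl yl /eqP ->; exact: h.
Qed.

Lemma leaf_walk l P : l \in L -> all isT l -> walk_check (size l) P -> P (map kind_of l).
Proof.
move=> lL aT; have := leaf_shift lL aT.
have hc : cycle (fun c d => kind_step c == d.1) (map kind_of l).
  apply: (leaf_cycle (f := kind_of) (R := fun c d => kind_step c == d.1) lL) => x xl.
  by have /andP [xT exT] := leaf_tris lL aT xl; rewrite kind_of_step.
have ok : all kind_ok (map kind_of l).
  apply/allP => c /mapP [x xl ->].
  by have /andP [xT exT] := leaf_tris lL aT xl; exact: kind_of_ok.
have : l != [::] by case/andP: (cycleL lL).
case: (l) hc ok => //= x p hc ok _ sh ck; apply: walk_checkP => //.
by rewrite size_map.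
Qed.

Lemma five_penta x : five x -> penta_next (kind_of x) = Some (kind_of (rot_ x)).
Proof.
case/fiveP => l [lL xl aT sl].
have /andP [+ _] : penta_check (map kind_of l) by apply: leaf_walk => //; rewrite sl; exact: walk_check5.
rewrite cycle_map => /next_cycle /(_ xl) /eqP.
by have /andP [_ /next_cycle /(_ xl) /eqP ->] := cycleL lL.
Qed.

Definition corner_kind x := if five x then Some (kind_of x) else None.

Definition angle x :=
  if five x then penta_angle (kind_of x)
  else rest_angle (corner_kind (dnext x)) (corner_kind (dnext (dnext x))).

Let flag x : kind * bool := (kind_of x, five (dnext x)).

Lemma five_glued x : x \in tris T -> five (dnext x) = five (e x).
Proof.
move=> xT; have xL : x \in flatten L by rewrite mem_L xT orbT.
by rewrite -(five_rot (eL xL)) /rot_ eK next_tri.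
Qed.

Lemma five_glued_kind x : x \in tris T -> five (dnext x) ->
  e x \in tris T /\ penta_next (kind_flip (kind_of x)) = Some (kind_of (dnext x)).
Proof.
move=> xT; rewrite five_glued // => fx; have /andP [exT _] := five_tris fx.
by rewrite -kind_of_flip // five_penta // /rot_ eK next_tri.
Qed.

(** The triangle of the corner [rot_ x] has its other corners at [e x] and [dnext (rot_ x)], the far
    ends of two consecutive edges. The flags tell which of these have degree five, and [penta_next]
    then recovers their kinds, so the angle depends on the two flagged kinds only. *)
Lemma flag_leaf l x : l \in L -> all isT l -> ~~ five_leaf l -> x \in l ->
  flag_compat (flag x) (flag (rot_ x)) /\ flag_angle (flag x) (flag (rot_ x)) = angle (rot_ x).
Proof.
move=> lL aT n5 xl; have yl := rot_leaf lL xl.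
have /andP [xT exT] := leaf_tris lL aT xl; have /andP [yT eyT] := leaf_tris lL aT yl.
have y5 : five (rot_ x) = false by rewrite (five_leafE lL yl) (negPf n5).
have y2 : dnext (dnext (rot_ x)) = e x by rewrite /rot_ next_tri // dnextK.
have fE z : ((flag z).1 = kind_of z) * ((flag z).2 = five (dnext z)) by [].
rewrite /flag_compat /flag_angle /angle y5 y2 /corner_kind -five_glued // !fE -(kind_of_flip xT exT).
split; last by case: ifP => // h; case: (five_glued_kind yT h) => _ ->.
apply/and3P; split.
- by apply/implyP => h; case: (five_glued_kind yT h) => _ ->.
- by apply/implyP; rewrite five_glued // => h; rewrite five_penta.
apply/implyP => /andP [hx hy]; have [_ ->] := five_glued_kind yT hy.
have zT := tris_dnext yT.
have h : five (dnext (dnext (rot_ x))) by rewrite y2 -five_glued.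
by have [_ h2] := five_glued_kind zT h; apply/eqP; rewrite -y2; exact: h2.
Qed.

Lemma path_sum_map (U V : Type) (g : U -> V) (f : V -> V -> nat) (a : U -> nat) z s :
  path (fun x y => f (g x) (g y) == a y) z s ->
  path_sum f (g z) (map g s) = sumn (map a s).
Proof. by elim: s z => //= y s IH z /andP [/eqP -> /IH ->]. Qed.

Lemma leaf_angle_le10 l : l \in L -> all isT l -> ~~ five_leaf l -> size l <= 10 ->
  241 <= sumn (map angle l).
Proof.
move=> lL aT n5 sl.
have l0 : l != [::] by case/andP: (cycleL lL).
have hc : angle_check (map kind_of l).
  apply: leaf_walk => //; apply: (allP walk_check_le10).
  move: n5 sl l0; rewrite /five_leaf aT /=.
  by case: (l) => // x p /=; case: (size p); do 9?case=> //.
have cf : cycle flag_compat (map flag l).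
  by apply: leaf_cycle => // x xl; case: (flag_leaf lL aT n5 xl).
have : cycle (fun x y => flag_angle (flag x) (flag y) == angle y) l.
  rewrite -[l]map_id; apply: (leaf_cycle (f := id)) => // x xl.
  by case: (flag_leaf lL aT n5 xl) => _ ->.
case: (l) l0 hc cf => // x p _ hc cf /= h0; have e1 := path_sum_map h0.
have := angle_checkP (x := flag x) (l := map flag p) cf.
rewrite -map_rcons => h.
have -> : angle x + sumn (map angle p) = sumn (map angle (rcons p x)).
  by rewrite map_rcons sumn_rcons addnC.
by rewrite -e1; apply: h; rewrite /= -map_comp.
Qed.

Lemma leaf_angle_ge22 l : l \in L -> all isT l -> ~~ five_leaf l ->
  22 * size l <= sumn (map angle l).
Proof.
move=> lL aT n5.
have ge y : y \in l -> 22 <= angle y.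
  move=> yl; have [x xl ey] : exists2 x, x \in l & y = rot_ x.
    exists (prev l y); first by rewrite mem_prev.
    by have /andP [_ /prev_cycle /(_ yl) /eqP] := cycleL lL.
  subst y; have [h1 h2] := flag_leaf lL aT n5 xl; rewrite -h2.
  have mk z : z \in l -> flag z \in [seq (c, b) | c <- all_kinds, b <- [:: false; true]].
    move=> zl; have /andP [zT ezT] := leaf_tris lL aT zl.
    apply/allpairsP; exists (flag z); split => //; first exact/kind_okP/kind_of_ok.
    by rewrite !inE; case: (flag z).2.
  have := allP (allP flag_angle_ge22 _ (mk _ xl)) _ (mk _ yl).
  move/implyP; apply; rewrite h1 /=.
  by have /andP [xT exT] := leaf_tris lL aT xl; rewrite kind_of_step.
elim: (l) ge => //= y s IH ge; rewrite mulnS leq_add ?ge ?inE ?eqxx //.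
by apply: IH => z zs; apply: ge; rewrite inE zs orbT.
Qed.

Lemma triangle_five x : x \in tris T ->
  ~~ [&& five x, five (dnext x) & five (dnext (dnext x))].
Proof.
move=> xT; apply/negP => /and3P [h0 h1 h2].
have [exT e1] := five_glued_kind xT h1.
have [_ e2] := five_glued_kind (tris_dnext xT) h2.
have h3 : five (dnext (dnext (dnext x))) by rewrite dnextK.
have [_ e3] := five_glued_kind (tris_dnext (tris_dnext xT)) h3.
have := allP no_penta_triangle _ (kind_okP (kind_of_ok xT exT)).
by rewrite e1 e2 e3 dnextK // eqxx.
Qed.

Lemma triangle_angle x : x \in tris T ->
  angle x + angle (dnext x) + angle (dnext (dnext x)) <= 120.
Proof.
move=> xT; have := triangle_five xT; rewrite /angle /corner_kind dnextK //.
have h y := penta_angle_le (kind_of y).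
move: (h x) (h (dnext x)) (h (dnext (dnext x))).
by case: (five x); case: (five (dnext x)); case: (five (dnext (dnext x))) => //=; lia.
Qed.

(** With the factor ten, an excess of one angle unit at a vertex of degree at most ten pays one unit
    to each of its corners. An outer corner carries the full turn [2400] and so pays for its whole
    vertex. *)
Let weight x := if isT x then 10 * angle x else 2400.
Let ordinary x : nat := isT x && ~~ five x.

Lemma ordinary_le x : ordinary x <= weight x.
Proof.
rewrite /ordinary /weight /angle; case: (isT x) => //=; case: (five x) => //=.
rewrite muln_gt0 /= /corner_kind.
have := penta_angle_le (kind_of (dnext x)); have := penta_angle_le (kind_of (dnext (dnext x))).
by case: (five _); case: (five _) => //=; lia.
Qed.

Lemma sumn_map_le (U : eqType) (f g : U -> nat) l :
  {in l, forall x, f x <= g x} -> sumn (map f l) <= sumn (map g l).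
Proof.
elim: l => //= x l IH h; rewrite leq_add ?h ?inE ?eqxx // IH // => y yl.
by apply: h; rewrite inE yl orbT.
Qed.

Lemma leaf_weight l : l \in L -> 2400 + sumn (map ordinary l) <= sumn (map weight l).
Proof.
move=> lL; have [aT|] := boolP (all isT l); last first.
  rewrite -has_predC => /hasP [x xl /= nT].
  rewrite (perm_sumn (perm_map ordinary (perm_to_rem xl))) (perm_sumn (perm_map weight (perm_to_rem xl))) /=.
  rewrite {1}/ordinary {1}/weight (negPf nT) /= add0n leq_add2l.
  by apply: sumn_map_le => y _; exact: ordinary_le.
have wE : sumn (map weight l) = 10 * sumn (map angle l).
  by elim: (l) aT => //= x s IH /andP [xT /IH ->]; rewrite /weight xT mulnDr.
rewrite wE; have [f5|n5] := boolP (five_leaf l).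
  have l5 x : x \in l -> five x by move=> xl; rewrite (five_leafE lL xl).
  have -> : map angle l = map penta_angle (map kind_of l).
    by rewrite -map_comp; apply/eq_in_map => x xl; rewrite /angle l5.
  have /andP [_ sl] := f5.
  have /andP [_ /eqP ->] : penta_check (map kind_of l).
    by apply: leaf_walk => //; rewrite (eqP sl); exact: walk_check5.
  have -> : map ordinary l = map (fun=> 0) l.
    by apply/eq_in_map => x xl; rewrite /ordinary l5 // andbF.
  by elim: (l).
have so : sumn (map ordinary l) <= size l.
  by elim: (l) => //= x s IH; rewrite -add1n leq_add // /ordinary leq_b1.
have [s10|s11] := leqP (size l) 10.
  by have := leaf_angle_le10 lL aT n5 s10; lia.
by have := leaf_angle_ge22 lL aT n5; lia.
Qed.

(** Summing [leaf_weight] over the vertices and replacing [2400 * size L] by Euler's formula cancels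
    the terms [1200 * size T]. What remains bounds the number of ordinary corners, and by
    [triangle_five] each triangle has one. *)
Lemma discharge_bound : size T <= 1200 * size B.
Proof.
have tot : 2400 * size L + sumn (map ordinary (flatten L)) <= sumn (map weight (flatten L)).
  have : {subset L <= L} by [].
  move: {1 3 4 5}L; elim=> [//|l M IH] sM /=.
  have := leaf_weight (sM l (mem_head _ _)).
  have := IH (fun m mM => sM m (@mem_behead _ (l :: M) m mM)).
  by rewrite !map_cat !sumn_cat; lia.
rewrite (perm_sumn (perm_map ordinary permL)) (perm_sumn (perm_map weight permL)) in tot.
rewrite !map_cat !sumn_cat in tot.
have wB : sumn (map weight B) <= 2400 * size B.
  elim: (B) side_bd => //= x s IH h; rewrite mulnS leq_add //.
    by rewrite /weight /isT ltnNge h ?mem_head.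
  by apply: IH => y ys; apply: h; rewrite inE ys orbT.
have wT : sumn (map weight (tris T)) <= 1200 * size T /\ size T <= sumn (map ordinary (tris T)).
  have sub f : f \in T -> f \in tris T.
    by move=> fT; apply/flattenP; exists (tri_darts f); rewrite ?mem_head //; apply: map_f.
  have : {subset T <= T} by [].
  move: {1 3 4 5 6}T; elim=> [//|f M IH] sM /=.
  have [h1 h2] := IH (fun m mM => sM m (@mem_behead _ (f :: M) m mM)).
  have fT := sub _ (sM f (mem_head _ _)).
  have tT y : y \in tris T -> isT y by move/tris_side => /andP [].
  have ww y : y \in tris T -> weight y = 10 * angle y by move=> yT; rewrite /weight tT.
  have oo y : y \in tris T -> ordinary y = ~~ five y by move=> yT; rewrite /ordinary tT.
  have := triangle_angle fT; have := triangle_five fT.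
  rewrite !ww ?oo ?tris_dnext //.
  move: h1 h2; rewrite /tris; set wM := sumn _; set oM := sumn (map ordinary _) => h1 h2.
  by case: (five f); case: (five (dnext f)); case: (five (dnext (dnext f))) => //= _ ?; split; lia.
case: wT => wT oT; move: euler tot wB wT oT.
set a := sumn (map ordinary B); set b := sumn _; set c := sumn _; set d := sumn _.
lia.
Qed.

End Discharge.

(** * The linear isoperimetric inequality *)

Fixpoint partner (E : seq (dart * dart)) (x : dart) : dart :=
  if E is (a, b) :: E' then
    if x == a then b else if x == b then a else partner E' x
  else x.

Lemma partner_notin E x : x \notin ends E -> partner E x = x.
Proof.
elim: E => //= -[a b] E IH; rewrite !inE !negb_or /= => /and3P [/negPf -> /negPf ->].
exact: IH.
Qed.

Lemma partner_edge E x : x \in ends E -> edge E x (partner E x).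
Proof.
elim: E => //= -[a b] E IH; rewrite !inE /= => /or3P [/eqP ->|/eqP ->|xE].
- by rewrite eqxx /edge mem_head.
- by rewrite eqxx /edge; case: eqP => [->|_]; rewrite mem_head ?orbT.
case: eqP => [->|_]; first by rewrite /edge mem_head.
case: eqP => [->|_]; first by rewrite /edge mem_head orbT.
by have := IH xE; rewrite /edge !inE => /orP [] ->; rewrite !orbT.
Qed.

Lemma partnerE E x y : uniq (ends E) -> edge E x y -> partner E x = y.
Proof.
move=> uE exy; have /andP [xE _] := mem_ends exy.
by apply: (edge_uniq uE (partner_edge xE) exy).
Qed.

Lemma partnerK E : uniq (ends E) -> involutive (partner E).
Proof.
move=> uE x; have [xE|xE] := boolP (x \in ends E); last by rewrite !partner_notin.
by apply: partnerE => //; rewrite edge_sym partner_edge.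
Qed.

Lemma uniq_tris T : all (fun f => f.2.2 < 3) T -> uniq (map fst T) -> uniq (tris T).
Proof.
have ids f x : x \in tri_darts f -> x.1 = f.1 by rewrite !inE => /or3P [] /eqP ->.
elim: T => //= f T IH /andP [f3 T3] /andP [fT uT]; rewrite /tris /= -/(tris T).
have sep x : x \in tri_darts f -> x \notin tris T.
  move=> xf; apply: contra fT => /flattenP [t /mapP [g gT ->] xg].
  by rewrite -(ids _ _ xf) (ids _ _ xg) map_f.
have h0 : f \notin tris T by apply: sep; rewrite !inE eqxx.
have h1 : dnext f \notin tris T by apply: sep; rewrite !inE eqxx orbT.
have h2 : dnext (dnext f) \notin tris T by apply: sep; rewrite !inE eqxx !orbT.
rewrite !inE !negb_or h0 h1 h2 IH // !andbT.
by case: (f) f3 => m [[i o] [|[|[|k]]]] //= _; case: o; rewrite !xpair_eqE /= !andbF.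
Qed.

(** Identifiers are positions in the word and may coincide with those of triangles; place [3] keeps
    the darts apart. *)
Definition outer_darts (w : seq letter) : seq dart :=
  [seq (p.1, (p.2.1, p.2.2, 3)) | p <- zip (iota 0 (size w)) w].

Lemma outer_lab n w : map (dlab n) (outer_darts w) = w.
Proof.
rewrite -map_comp.
have: forall m, [seq dlab n (p.1, (p.2.1, p.2.2, 3)) | p <- zip (iota m (size w)) w] = w.
  by elim: w => //= -[i o] w IH m; rewrite IH.
exact.
Qed.

Lemma uniq_outer w : uniq (outer_darts w).
Proof.
apply: (@map_uniq _ _ fst); rewrite -map_comp.
by rewrite (eq_map (g := fst)) // -/unzip1 unzip1_zip ?iota_uniq // size_iota.
Qed.

Lemma outer_place w x : x \in outer_darts w -> x.2.2 = 3.
Proof. by case/mapP => p _ ->. Qed.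

Definition face_next (B : seq dart) (x : dart) : dart := if x.2.2 < 3 then dnext x else next B x.

Lemma chains_outer nx e d0 d p : involutive e ->
  chains nx e (e d) [::] [seq (x, [::]) | x <- p] [:: d0] =
    path (fun x y => y == nx x) d (rcons p d0).
Proof.
move=> eK; elim: p d => [|x p IH] d /=; first by rewrite eK.
by rewrite eK andbT IH.
Qed.

Lemma well_chained_outer e B : involutive e -> {in B, forall x, x.2.2 = 3} -> uniq B ->
  B != [::] -> well_chained (face_next B) e [::] [seq (x, [::]) | x <- B].
Proof.
move=> eK; case: B => [//|d p] B3 uB _; rewrite [well_chained _ _ _ _]/=.
rewrite chains_outer //; have := cycle_next uB.
apply: (@sub_in_cycle _ (mem (d :: p)) _ _ _ (d :: p)); last by apply/allP.
by move=> x y xB _ /eqP <-; rewrite /face_next B3.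
Qed.

Lemma tri_darts_place f x : f.2.2 < 3 -> x \in tri_darts f -> x.2.2 < 3.
Proof.
by case: f => m [[i o] k] h; rewrite !inE => /or3P [] /eqP -> //=; rewrite ltn_mod.
Qed.

Lemma fill_area n w N : 11 <= n -> n != 12 -> n != 14 -> fill n w N ->
  exists2 M, M <= 1200 * size w & fill n w M.
Proof.
move=> n11 n12 n14.
case ew : w => [|a w']; first by move=> _; exists 0 => //; constructor.
rewrite -ew; elim/ltn_ind: N => N IH fN.
have w0 : outer_darts w != [::] by rewrite ew.
set B := outer_darts w in w0; pose s0 : seq (dart * seq dart) := [seq (x, [::]) | x <- B].
have ps0 : pend s0 = B by rewrite /pend -map_comp map_id.
have [L [E [T [D sT uT aT]]]] := fill_diag fN 0 [::] (s := s0) (etrans (congr1 _ ps0) (outer_lab n w)).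
have T3 : all (fun f => f.2.2 < 3) T.
  by apply: sub_all aT => f /andP [_ /andP []].
have B3 := @outer_place w.
have tris3 x : x \in tris T -> x.2.2 < 3.
  by case/flattenP => t /mapP [f /(allP T3) f3 ->]; exact: tri_darts_place.
have uBT : uniq (B ++ tris T).
  rewrite cat_uniq uniq_outer uniq_tris // andbT; apply/hasPn => x xT.
  by apply/negP => /B3 e3; move: (tris3 x xT); rewrite e3.
have uE : uniq (ends E) by rewrite (perm_uniq (diag_ends D)) ps0.
have pL : perm_eq (flatten L) (B ++ tris T).
  have := diag_leaves D; rewrite ps0 -[flatten (map _ s0)]/(flatten (map snd s0)).
  have -> // : flatten (map snd s0) = [::] by rewrite /s0; elim: (B).
have pE : perm_eq (ends E) (flatten L).
  by rewrite (perm_trans (diag_ends D)) // ps0 perm_sym.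
have eL x : x \in flatten L -> edge E x (partner E x).
  by rewrite -(perm_mem pE); exact: partner_edge.
(* A cancelling pair gives a smaller filling of the same word; without one, the diagram is reduced
   and the discharging applies. *)
have [/hasP [x xT /andP [exT mx]]|nm] := boolP (has (fun x => (partner E x \in tris T) && mirror x (partner E x)) (tris T)).
  have xL : x \in flatten L by rewrite (perm_mem pL) mem_cat xT orbT.
  have [|M hM fM] := diag_mirror D _ (eL x xL) xT exT mx.
    by rewrite ps0.
  by apply: (IH M); [rewrite -sT | rewrite ps0 outer_lab in fM].
exists N => //; rewrite -sT.
have -> : size w = size B by rewrite size_map size_zip size_iota minnn.
apply: (@discharge_bound n L B T (partner E) (face_next B)) => //.
- by rewrite (perm_uniq pL).
- exact: partnerK.
- by move=> x /eL /mem_ends /andP [_]; rewrite (perm_mem pE).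
- move=> x /eL /orP [] /(diag_lab D) /= -> //; by rewrite inv_letterK.
- move=> l lL; apply: (diag_cycle (partnerK uE) D _ _ _ lL).
  + move=> [x y] xyE /=; apply: partnerE => //; by rewrite /edge xyE.
  + by move=> x /tris3; rewrite /face_next => ->.
  + by apply: well_chained_outer => //; [exact: partnerK | exact: uniq_outer].
- by move=> x /tris3; rewrite /face_next => ->.
- by move=> x xB; rewrite /face_next B3 //= mem_next.
- by move=> x /B3 ->.
- by apply: sub_all aT => f /andP [].
- by move=> x xT exT; move/hasPn: nm => /(_ x xT); rewrite exT.
- by rewrite (diag_euler D) size_map.
Qed.

(** * Fillings in the Cayley complex *)

Notation word := (seq letter).

Lemma Hn3_eq_cat n u u' x y : Hn3_eq n u u' -> Hn3_eq n (x ++ u ++ y) (x ++ u' ++ y).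
Proof.
elim=> {u u'}.
- by move=> u; constructor.
- by move=> u v _; apply: Hn3_sym.
- by move=> u v w _ h1 _ h2; exact: Hn3_trans h1 h2.
- by move=> u v a; rewrite -!catA !(catA x); exact: Hn3_free.
- by move=> u v i hi; rewrite -!catA !(catA x); exact: Hn3_rel.
Qed.

Lemma Hn3_eq_catr n u u' y : Hn3_eq n u u' -> Hn3_eq n (u ++ y) (u' ++ y).
Proof. exact: (@Hn3_eq_cat n u u' [::] y). Qed.

Lemma Hn3_eq_catl n u u' x : Hn3_eq n u u' -> Hn3_eq n (x ++ u) (x ++ u').
Proof. by move=> h; have := Hn3_eq_cat x [::] h; rewrite !cats0. Qed.

Lemma Hn3_eq_inv n a : Hn3_eq n [:: a; inv_letter a] [::].
Proof. exact: (@Hn3_free n [::] [::] a). Qed.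

Definition inv_word (w : word) : word := rev (map inv_letter w).

Lemma Hn3_eq_invr n w : Hn3_eq n (w ++ inv_word w) [::].
Proof.
elim: w => [|a w IH]; first by constructor.
rewrite /inv_word /= rev_cons -cats1 catA.
apply: Hn3_trans (Hn3_eq_inv n a).
exact: (@Hn3_eq_cat n _ _ [:: a] [:: inv_letter a] IH).
Qed.

Lemma inv_wordK : involutive inv_word.
Proof. by move=> w; rewrite /inv_word map_rev revK mapK //; exact: inv_letterK. Qed.

Lemma Hn3_eq_invl n w : Hn3_eq n (inv_word w ++ w) [::].
Proof. by have := Hn3_eq_invr n (inv_word w); rewrite inv_wordK. Qed.

Lemma Hn3_eq_cancel n u v w : Hn3_eq n (u ++ v) (u ++ w) -> Hn3_eq n v w.
Proof.
move=> h; have e x : Hn3_eq n (inv_word u ++ u ++ x) x.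
  by have := Hn3_eq_catr x (Hn3_eq_invl n u); rewrite -catA.
apply: (Hn3_trans (Hn3_sym (e v))); apply: Hn3_trans (e w).
exact: Hn3_eq_catl.
Qed.

Lemma rel3_eq n a b c : rel3 n a b c -> Hn3_eq n [:: a; b; c] [::].
Proof.
have r i : i < n -> Hn3_eq n (Hn3_relator n i) [::] by exact: (@Hn3_rel n [::] [::] i).
have rot x y z : Hn3_eq n [:: x; y; z] [::] -> Hn3_eq n [:: y; z; x] [::].
  move=> h; apply: (@Hn3_eq_cancel n [:: x]).
  exact: (@Hn3_eq_catr n _ _ [:: x] h).
have inv x y z : Hn3_eq n [:: x; y; z] [::] ->
    Hn3_eq n [:: inv_letter z; inv_letter y; inv_letter x] [::].
  move=> h; apply: (@Hn3_eq_cancel n [:: x; y; z]).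
  exact: Hn3_trans (Hn3_eq_invr n [:: x; y; z]) (Hn3_sym h).
case=> -[[i o] [|[|[|k]]]] /andP [//= hi _]; case: o; have h := r i hi.
- by do 2!apply: (rot); exact: (inv _ _ _ h).
- exact: h.
- by apply: rot; exact: (inv _ _ _ h).
- by apply: rot; exact: h.
- exact: (inv _ _ _ h).
- by do 2!apply: (rot); exact: h.
Qed.

Lemma fill_sound n w N : fill n w N -> Hn3_eq n w [::].
Proof.
elim=> {w N} [|a p q w N r _ IH|a u v N1 N2 _ IH1 _ IH2].
- by constructor.
- apply: Hn3_trans IH; apply: (@Hn3_eq_cancel n [:: inv_letter a]).
  have h1 := Hn3_eq_inv n (inv_letter a); rewrite inv_letterK in h1.
  apply: (Hn3_trans (Hn3_eq_catr w h1)); apply: Hn3_sym.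
  exact: (Hn3_eq_catr w (rel3_eq r)).
- apply: Hn3_trans (Hn3_trans (Hn3_eq_catr v (Hn3_eq_inv n a)) IH2).
  exact: (@Hn3_eq_cat n _ _ [:: a] (inv_letter a :: v) IH1).
Qed.

Lemma rel3_valid n a b c : rel3 n a b c -> valid_word n [:: a; b; c].
Proof.
case=> -[[i o] k] /andP [/= hi hk]; have n0 : 0 < n by case: n hi.
by case: k hk => [|[|[|k]]] //; case: o => //= _; rewrite ?hi ?ltn_mod ?n0.
Qed.

Lemma valid_cat n u v : valid_word n (u ++ v) = valid_word n u && valid_word n v.
Proof. exact: all_cat. Qed.

Lemma valid_inv_word n w : valid_word n (inv_word w) = valid_word n w.
Proof. by rewrite /valid_word all_rev all_map; apply: eq_all. Qed.

Definition adjacent n (u v : word) := exists2 a, a.1 < n & Hn3_eq n (rcons u a) v.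

Definition is_triangle n (t : word * word * word) : Prop :=
  let: (u, v, w) := t in
  [/\ valid_word n u, valid_word n v & valid_word n w] /\
  [/\ adjacent n u v, adjacent n v w & adjacent n u w].

(** * Edge functions modulo 2 on the Cayley complex *)

Section Parity.

Variables (n : nat) (chi : word -> word -> bool).
Hypothesis chi_sym : forall u v, chi u v = chi v u.
Hypothesis chi_eq : forall u u' v, Hn3_eq n u u' -> chi u v = chi u' v.

Fixpoint path_parity (g w : word) : bool :=
  if w is a :: w' then chi g (rcons g a) (+) path_parity (rcons g a) w' else false.

Definition tri_parity (t : word * word * word) : bool :=
  let: (u, v, w) := t in chi u v (+) chi v w (+) chi u w.

Definition tris_parity (F : seq (word * word * word)) : bool :=
  foldr (fun t b => tri_parity t (+) b) false F.

Lemma path_parity_cat g u v : path_parity g (u ++ v) = path_parity g u (+) path_parity (g ++ u) v.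
Proof.
elim: u g => [|a u IH] g /=; first by rewrite cats0.
by rewrite IH addbA cat_rcons.
Qed.

Lemma chi_eq2 u u' v v' : Hn3_eq n u u' -> Hn3_eq n v v' -> chi u v = chi u' v'.
Proof. by move=> hu hv; rewrite (chi_eq _ hu) chi_sym (chi_eq _ hv) chi_sym. Qed.

Lemma path_parity_eq g g' w : Hn3_eq n g g' -> path_parity g w = path_parity g' w.
Proof.
elim: w g g' => //= a w IH g g' h.
have h' : Hn3_eq n (rcons g a) (rcons g' a) by rewrite -!cats1; exact: Hn3_eq_catr.
by rewrite (chi_eq2 h h') (IH _ _ h').
Qed.

Lemma tris_parity_cat F G : tris_parity (F ++ G) = tris_parity F (+) tris_parity G.
Proof. by elim: F => //= t F ->; rewrite addbA. Qed.

Lemma path_parity0 g w :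
  (forall i, i < size w -> chi (g ++ take i w) (g ++ take i.+1 w) = false) ->
  path_parity g w = false.
Proof.
elim: w g => //= a w IH g h.
have := h 0 isT; rewrite /= !take0 cats0 cats1 => -> /=.
by apply: IH => i hi; have := h i.+1 hi; rewrite -!cat_rcons.
Qed.

End Parity.

(** Stokes' theorem modulo 2: glued edges are counted twice and cancel. The list [F] is chosen
    before [chi], so that one list serves all the cuts used later. *)
Lemma fill_triangles n w N : fill n w N -> valid_word n w -> forall g, valid_word n g ->
  exists F, [/\ size F = N, {in F, forall t, is_triangle n t} &
    forall chi, (forall u v, chi u v = chi v u) ->
      (forall u u' v, Hn3_eq n u u' -> chi u v = chi u' v) ->
      path_parity chi g w = tris_parity chi F].
Proof.
elim=> {w N} [|a p q w N r f IH|a u v N1 N2 f1 IH1 f2 IH2].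
- by move=> _ g _; exists [::].
- move=> /andP [ha hw] g hg; have := rel3_valid r; rewrite /= andbT => /and3P [_ hp hq].
  have [|F [sF tF pF]] := IH _ g hg; first by rewrite /= hp hq.
  have eA : Hn3_eq n (rcons g a) (rcons (rcons g p) q).
    rewrite -!cats1 -catA; apply: Hn3_eq_catl; apply: (@Hn3_eq_cancel n [:: inv_letter a]).
    apply: (Hn3_trans _ (Hn3_sym (rel3_eq r))).
    by have := Hn3_eq_inv n (inv_letter a); rewrite inv_letterK.
  exists ((g, rcons g p, rcons (rcons g p) q) :: F); split => /=; first by rewrite sF.
    move=> t; rewrite inE => /predU1P [->|/tF //].
    split; split.
    + by [].
    + by rewrite -cats1 valid_cat hg /= hp.
    + by rewrite -!cats1 !valid_cat hg /= hp hq.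
    + by exists p => //; constructor.
    + by exists q => //; constructor.
    + by exists a.
  move=> chi cs ce; rewrite -(pF chi cs ce) /= (path_parity_eq cs ce w eA).
  rewrite (chi_eq2 cs ce (Hn3_refl n g) eA) !addbA.
  by case: (chi g _); case: (chi _ _); case: (chi _ _); case: (path_parity _ _ _).
- rewrite /= valid_cat /= => /and4P [ha hu _ hv] g hg.
  have hga : valid_word n (rcons g a) by rewrite -cats1 valid_cat hg /= ha.
  have [F1 [s1 t1 p1]] := IH1 hu _ hga; have [F2 [s2 t2 p2]] := IH2 hv g hg.
  exists (F1 ++ F2); split; first by rewrite size_cat s1 s2.
    by move=> t; rewrite mem_cat => /orP [/t1|/t2].
  move=> chi cs ce; rewrite /= path_parity_cat /= tris_parity_cat (p1 _ cs ce) -(p2 _ cs ce).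
  have e1 : Hn3_eq n (rcons g a ++ u) (rcons g a).
    by rewrite -[X in Hn3_eq n _ X]cats0; apply: Hn3_eq_catl; exact: fill_sound f1.
  have e2 : Hn3_eq n (rcons (rcons g a ++ u) (inv_letter a)) g.
    rewrite -cats1; apply: (Hn3_trans (Hn3_eq_catr _ e1)).
    rewrite -cats1 -catA -[X in Hn3_eq n _ X]cats0; apply: Hn3_eq_catl; exact: Hn3_eq_inv.
  rewrite (path_parity_eq cs ce v e2) (chi_eq2 cs ce e1 e2) (cs _ g).
  by case: (chi _ _); case: (tris_parity _ _); case: (path_parity _ _ _).
Qed.

(** * The word metric *)

Definition joins n (u v : seq letter) (k : nat) : Prop :=
  exists w, [/\ valid_word n w, size w = k & Hn3_eq n (u ++ w) v].

Definition least (Q : pred nat) : nat :=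
  if pselect (exists k, Q k) is left h then ex_minn h else 0.

(* The junk value [0] occurs only if [u] and [v] differ by an element outside
   the subgroup generated by the valid letters. *)
Definition dist n (u v : seq letter) : nat := least (fun k => `[< joins n u v k >]).

Lemma dist_eq n u u' v v' : Hn3_eq n u u' -> Hn3_eq n v v' -> dist n u v = dist n u' v'.
Proof.
move=> hu hv; rewrite /dist; congr least.
apply/funext => k; apply: asbool_equiv_eq.
split=> -[w [vw sw ew]]; exists w; split => //.
  by apply: Hn3_trans (Hn3_trans ew hv); exact/Hn3_eq_catr/Hn3_sym.
by apply: Hn3_trans (Hn3_trans ew (Hn3_sym hv)); exact: Hn3_eq_catr.
Qed.

Lemma joinsP n u v : valid_word n u -> valid_word n v -> exists k, joins n u v k.
Proof.
move=> hu hv; exists (size (inv_word u ++ v)), (inv_word u ++ v); split=> //.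
  by rewrite valid_cat valid_inv_word hu.
by rewrite catA; exact: (Hn3_eq_catr v (Hn3_eq_invr n u)).
Qed.

Lemma dist_joins n u v : valid_word n u -> valid_word n v -> joins n u v (dist n u v).
Proof.
move=> hu hv; rewrite /dist /least; case: pselect => [h|[]].
  by case: ex_minnP => k /asboolP.
by have [k hk] := joinsP hu hv; exists k; apply/asboolP.
Qed.

Lemma dist_le n u v w : valid_word n w -> Hn3_eq n (u ++ w) v -> dist n u v <= size w.
Proof.
move=> hw e; rewrite /dist /least; case: pselect => // h; case: ex_minnP => k _; apply.
by apply/asboolP; exists w.
Qed.

Lemma dist0 n u : dist n u u = 0.
Proof.
by apply/eqP; rewrite -leqn0 (@dist_le n u u [::]) // cats0; constructor.
Qed.

Lemma dist_sym n u v : valid_word n u -> valid_word n v -> dist n u v = dist n v u.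
Proof.
have le x y : valid_word n x -> valid_word n y -> dist n x y <= dist n y x.
  move=> hx hy; have [w [vw sw ew]] := dist_joins hy hx.
  rewrite -sw -[size w](size_map inv_letter) -size_rev.
  apply: dist_le; first by rewrite valid_inv_word.
  apply: (Hn3_trans (Hn3_eq_catr _ (Hn3_sym ew))); rewrite -catA -[X in Hn3_eq n _ X]cats0.
  by apply: Hn3_eq_catl; exact: Hn3_eq_invr.
by move=> hu hv; apply/eqP; rewrite eqn_leq !le.
Qed.

Lemma dist_tri n u v w : valid_word n u -> valid_word n v -> valid_word n w ->
  dist n u w <= dist n u v + dist n v w.
Proof.
move=> hu hv hw; have [x [vx sx ex]] := dist_joins hu hv; have [y [vy sy ey]] := dist_joins hv hw.
rewrite -sx -sy -size_cat; apply: dist_le; first by rewrite valid_cat vx.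
by rewrite catA; apply: Hn3_trans ey; exact: Hn3_eq_catr.
Qed.

Lemma dist_adjacent n u v : adjacent n u v -> dist n u v <= 1.
Proof. by case=> a ha e; apply: (@dist_le n u v [:: a]); rewrite /= ?ha // cats1. Qed.

Lemma dist_geod_take n u w : valid_word n u -> valid_word n w -> size w = dist n u (u ++ w) ->
  forall i j, i <= j -> j <= size w -> dist n (u ++ take i w) (u ++ take j w) = j - i.
Proof.
move=> hu hw sw i j ij jw.
have vt k : valid_word n (take k w) by move: hw; rewrite -{1}(cat_take_drop k w) valid_cat => /andP [].
have vd k : valid_word n (drop k w) by move: hw; rewrite -{1}(cat_take_drop k w) valid_cat => /andP [].
have vut k : valid_word n (u ++ take k w) by rewrite valid_cat hu vt.
have vuw : valid_word n (u ++ w) by rewrite valid_cat hu.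
have le a b : a <= b -> b <= size w -> dist n (u ++ take a w) (u ++ take b w) <= b - a.
  move=> ab bw; have -> : b - a = size (drop a (take b w)) by rewrite size_drop size_take_min; lia.
  apply: dist_le.
    by move: (vt b); rewrite -{1}(cat_take_drop a (take b w)) valid_cat => /andP [].
  by rewrite -catA -{1}(take_takel w ab) cat_take_drop; constructor.
have h1 := le 0 i (leq0n i) (leq_trans ij jw); rewrite take0 cats0 subn0 in h1.
have h2 := le i j ij jw.
have h3 := le j (size w) jw (leqnn _); rewrite take_size in h3.
have t1 := dist_tri hu (vut i) vuw; have t2 := dist_tri (vut i) (vut j) vuw.
by rewrite -sw in t1; lia.
Qed.

Lemma double_count (T U : eqType) (hit : T -> U -> bool) (F : seq T) (P : seq U) :
  uniq P -> {in F & P, forall t x, hit t x -> {in P, forall y, hit t y -> x = y}} ->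
  {in P, forall x, has (hit^~ x) F} -> size P <= size F.
Proof.
elim: F P => [|t F IH] P uP inj cov.
  by case: P cov {uP inj} => // x P /(_ x (mem_head _ _)).
rewrite -(count_predC (hit t)) [size (_ :: _)]/= -add1n leq_add //.
  rewrite -size_filter; case e : (filter _ P) => [|x [|y s]] //=.
  have := filter_uniq (hit t) uP; rewrite e /= inE negb_or => /andP [/andP [/negP nxy _] _].
  have hx : x \in filter (hit t) P by rewrite e mem_head.
  have hy : y \in filter (hit t) P by rewrite e !inE eqxx orbT.
  move: hx hy; rewrite !mem_filter => /andP [hx xP] /andP [hy yP].
  by case: nxy; apply/eqP; apply: (inj t x (mem_head _ _) xP).
rewrite -size_filter; apply: IH; first exact: filter_uniq.
  move=> t' x t'F; rewrite mem_filter => /andP [_ xP] hx y; rewrite mem_filter => /andP [_ yP].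
  by apply: (inj t' x _ xP hx y yP); rewrite inE t'F orbT.
move=> x; rewrite mem_filter => /andP [/= nx xP].
by have := cov x xP; rewrite /= (negPf nx).
Qed.

(** * Cuts of balls and the triangles that detect them *)

Section Slices.

Variables (n : nat) (p : seq letter).
Hypothesis vp : valid_word n p.

(* Detects the edges of the ball of radius [s] around [p] which leave the ball
   of radius [t] around [z]. *)
Definition cut (z : seq letter) (s t : nat) (u v : seq letter) : bool :=
  [&& dist n p u <= s, dist n p v <= s & (dist n z u <= t) (+) (dist n z v <= t)].

Lemma cut_sym z s t u v : cut z s t u v = cut z s t v u.
Proof. by rewrite /cut andbCA addbC. Qed.

Lemma cut_eq z s t u u' v : Hn3_eq n u u' -> cut z s t u v = cut z s t u' v.
Proof.
by move=> e; rewrite /cut (dist_eq (Hn3_refl n p) e) (dist_eq (Hn3_refl n z) e).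
Qed.

Lemma dist_lip z u v : valid_word n z -> valid_word n u -> valid_word n v -> adjacent n u v ->
  (dist n z u <= (dist n z v).+1) && (dist n z v <= (dist n z u).+1).
Proof.
move=> vz vu vv /dist_adjacent h.
have h1 := dist_tri vz vu vv; have h2 := dist_tri vz vv vu.
by rewrite (dist_sym vv vu) in h2; lia.
Qed.

(* Inside a triangle the edges of a cut cancel, unless exactly one vertex lies
   outside the ball; so such a triangle determines [s], and then [t]. *)
Lemma cut_inj (z : nat -> seq letter) F s t s' t' : (forall s, valid_word n (z s)) ->
  is_triangle n F -> tri_parity (cut (z s) s t) F -> tri_parity (cut (z s') s' t') F ->
  (s = s') /\ (t = t').
Proof.
case: F => [[u v] w] vz [[vu vv vw] [uv vw' uw]].
have /andP [a1 a2] := dist_lip vp vu vv uv.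
have /andP [a3 a4] := dist_lip vp vv vw vw'.
have /andP [a5 a6] := dist_lip vp vu vw uw.
have out r k : tri_parity (cut (z r) r k) (u, v, w) ->
    [\/ [/\ dist n p u = r.+1, dist n p v = r, dist n p w = r &
          k = minn (dist n (z r) v) (dist n (z r) w)],
       [/\ dist n p u = r, dist n p v = r.+1, dist n p w = r &
          k = minn (dist n (z r) u) (dist n (z r) w)] |
       [/\ dist n p u = r, dist n p v = r, dist n p w = r.+1 &
          k = minn (dist n (z r) u) (dist n (z r) v)]].
  have /andP [b1 b2] := dist_lip (vz r) vu vv uv.
  have /andP [b3 b4] := dist_lip (vz r) vv vw vw'.
  have /andP [b5 b6] := dist_lip (vz r) vu vw uw.
  rewrite /tri_parity /cut.
  move: (dist n p u) (dist n p v) (dist n p w) a1 a2 a3 a4 a5 a6 => hu hv hw a1 a2 a3 a4 a5 a6.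
  move: (dist n (z r) u) (dist n (z r) v) (dist n (z r) w) b1 b2 b3 b4 b5 b6 => gu gv gw b1 b2 b3 b4 b5 b6.
  case: (leqP hu r) => h1; case: (leqP hv r) => h2; case: (leqP hw r) => h3 //=;
  case: (leqP gu k) => g1; case: (leqP gv k) => g2; case: (leqP gw k) => g3 //= _;
  first [by exfalso; lia | by apply: Or31; split; lia | by apply: Or32; split; lia
        | by apply: Or33; split; lia].
move=> /out h1 /out h2.
have es : s = s'.
  by case: h1 => -[e1 e2 e3 _]; case: h2 => -[e4 e5 e6 _]; move: e4 e5 e6; rewrite e1 e2 e3; lia.
subst s'; split=> //.
by case: h1 => -[e1 e2 e3 ->]; case: h2 => -[e4 e5 e6 ->] //; exfalso;
  move: e4 e5 e6; rewrite e1 e2 e3; lia.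
Qed.

End Slices.

Lemma path_parity_pick chi g w m :
  (forall i, i < size w -> chi (g ++ take i w) (g ++ take i.+1 w) = (i == m)) ->
  path_parity chi g w = (m < size w).
Proof.
elim: w g m => //= a w IH g m h.
have := h 0 isT; rewrite /= !take0 cats0 cats1 => ->.
have h' i : i < size w -> chi (rcons g a ++ take i w) (rcons g a ++ take i.+1 w) = (i.+1 == m).
  by move=> hi; have := h i.+1 hi; rewrite -!cat_rcons.
case: m h' {h} => [|m] h' /=; first by rewrite path_parity0.
by rewrite ltnS -(IH _ _ h').
Qed.

(** Steps may have length zero, so [c] can be shorter than [gam]. It visits only points of [gam],
    hence stays as far from any centre as [gam] does. *)
Lemma path_word n u q gam : all (valid_word n) (q :: gam) -> Hn3_eq n u q ->
  path (fun x y => dist n x y <= 1) q gam ->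
  exists c, [/\ valid_word n c, size c <= size gam, Hn3_eq n (u ++ c) (last q gam) &
    forall i, exists2 z, z \in q :: gam & Hn3_eq n (u ++ take i c) z].
Proof.
elim: gam u q => [|y gam IH] u q /=.
  move=> _ e _; exists [::]; split => //; first by rewrite cats0.
  by move=> i; exists q; rewrite ?mem_head //= cats0.
case/andP => vq vgam e /andP [d1 hp].
have vy : valid_word n y by case/andP: vgam.
have [l [vl sl el]] := dist_joins vq vy.
have e1 : Hn3_eq n (u ++ l) y by apply: Hn3_trans el; exact: Hn3_eq_catr.
have [c [vc sc ec tc]] := IH (u ++ l) y vgam e1 hp.
exists (l ++ c); split.
- by rewrite valid_cat vl.
- by rewrite size_cat -add1n leq_add // sl.
- by rewrite catA.
- move=> i; rewrite take_cat; case: ltnP => hi; last first.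
    by rewrite catA; have [z zg ez] := tc (i - size l); exists z => //; rewrite inE zg orbT.
  have -> : i = 0 by move: d1 hi; rewrite sl; lia.
  by exists q; rewrite ?mem_head // take0 cats0.
Qed.

(** Positions along a geodesic with the centre at [A]: the ball covers the positions from [A - s] to
    [A + s], and distances to its entry point increase along them, so exactly one step crosses level
    [t]. Sums of two truncated differences are absolute values. *)
Lemma cut_index A s t i : s <= A -> t < 2 * s ->
  [&& A - i + (i - A) <= s, A - i.+1 + (i.+1 - A) <= s &
      (A - s - i + (i - (A - s)) <= t) (+) (A - s - i.+1 + (i.+1 - (A - s)) <= t)]
  = (i == A - s + t).
Proof.
move=> sA ts; apply/and3P/eqP; last by move=> ->; split; lia.
case=> h1 h2; case: (leqP _ t) => h3; case: (leqP _ t) => h4 //= _; lia.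
Qed.

Lemma cut_bound A s t : s <= A -> t < 2 * s -> A - s + t < A + s.
Proof. by lia. Qed.

Lemma loop_area n p q1 q2 gam R : 11 <= n -> n != 12 -> n != 14 ->
  valid_word n p -> valid_word n q1 -> all (valid_word n) (q2 :: gam) ->
  dist n q1 q2 = dist n q1 p + dist n p q2 ->
  path (fun x y => dist n x y <= 1) q2 gam -> last q2 gam = q1 ->
  all (fun z => 2 * R <= dist n p z) (q2 :: gam) ->
  R * R <= 600 * (dist n q1 q2 + size gam).
Proof.
move=> n11 n12 n14 vp vq1 vgam geod hgam lgam far.
have vq2 : valid_word n q2 by case/andP: vgam.
have [a [va sa ea]] := dist_joins vq1 vp.
have [b [vb sb eb]] := dist_joins vp vq2.
set w := a ++ b; set A := size a.
have vw : valid_word n w by rewrite valid_cat va.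
have ew : Hn3_eq n (q1 ++ w) q2 by rewrite catA; apply: Hn3_trans eb; exact: Hn3_eq_catr.
have sw : size w = dist n q1 q2 by rewrite size_cat sa sb.
have [c [vc sc ec tc]] := path_word vgam ew hgam.
have eW : Hn3_eq n (w ++ c) [::].
  by apply: (@Hn3_eq_cancel n q1); rewrite cats0 catA -{2}lgam.
have vW : valid_word n (w ++ c) by rewrite valid_cat vw.
have [N0 f0] := fillable_eq eW.
have [N hN fN] := fill_area n11 n12 n14 f0.
have [F [sF tF pF]] := fill_triangles fN vW vq1.
have geoW : size w = dist n q1 (q1 ++ w).
  by rewrite sw; apply: dist_eq; [constructor | exact: Hn3_sym].
pose v j := q1 ++ take j w.
have vv j : valid_word n (v j).
  by rewrite valid_cat vq1; move: vw; rewrite -{1}(cat_take_drop j w) valid_cat => /andP [].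
have dv i j : i <= size w -> j <= size w -> dist n (v i) (v j) = (i - j) + (j - i).
  move=> hi hj; case: (leqP i j) => ij.
    by rewrite (dist_geod_take vq1 vw geoW ij hj) (eqP (_ : i - j == 0)) ?subn_eq0.
  by rewrite dist_sym // (dist_geod_take vq1 vw geoW (ltnW ij) hi)
    (eqP (_ : j - i == 0)) ?addn0 ?subn_eq0 1?ltnW.
have ep : Hn3_eq n p (v A) by rewrite /v /w take_size_cat //; exact: Hn3_sym.
have Aw : A <= size w by rewrite size_cat leq_addr.
have dp j : j <= size w -> dist n p (v j) = (A - j) + (j - A).
  by move=> hj; rewrite (dist_eq ep (Hn3_refl n (v j))) dv.
have RA : 2 * R <= A.
  rewrite /A sa dist_sym //; move/allP: far; apply; by rewrite -lgam mem_last.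
have RB : A + 2 * R <= size w.
  by rewrite size_cat leq_add2l sb; case/andP: far.
(* The geodesic enters the ball of radius [s] around [p] at [z s]. *)
pose z s := v (A - s).
(* The cut is crossed once by the geodesic and never by [c], which stays outside the ball; an odd
   boundary count needs an odd triangle. Taking [R <= s] makes the range of [t] uniform, as
   [2 * R <= 2 * s]. *)
have key s t : R <= s < 2 * R -> t < 2 * R -> tris_parity (cut n p (z s) s t) F.
  move=> /andP [Rs sR] tR.
  rewrite -(pF _ (@cut_sym n p (z s) s t) (@cut_eq n p (z s) s t)) path_parity_cat.
  rewrite (path_parity0 (w := c)) ?addbF => [|i hi]; last first.
    have [y yg ey] := tc i; rewrite /cut (dist_eq (Hn3_refl n p) ey).
    by rewrite leqNgt (leq_trans sR (allP far _ yg)).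
  have sA : s <= A by rewrite (leq_trans (ltnW sR)).
  have t2s : t < 2 * s by rewrite (leq_trans tR) // leq_pmul2l.
  have zw : A - s <= size w by rewrite (leq_trans (leq_subr _ _)).
  rewrite (@path_parity_pick _ _ _ (A - s + t)).
    apply: leq_trans RB; apply: (@leq_trans (A + s)); [exact: cut_bound | ].
    by rewrite leq_add2l ltnW.
  by move=> i hi; rewrite /cut -!/(v _) /z !dv ?dp ?(ltnW hi) //; exact: cut_index.
pose P := [seq (s, t) | s <- iota R R, t <- iota 0 (2 * R)].
have sP : size P <= size F.
  apply: (@double_count _ _ (fun T st => tri_parity (cut n p (z st.1) st.1 st.2) T)).
  - by apply: allpairs_uniq; rewrite ?iota_uniq // => -[x y] [x' y'] _ _ /= [-> ->].
  - move=> T [s t] TF _ /= h1 [s' t'] _ /= h2.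
    by have [-> ->] := @cut_inj n p vp z T s t s' t' (fun r => vv _) (tF _ TF) h1 h2.
  - move=> st /allpairsP [[s t] [hs ht ->]] /=.
    have := key s t; rewrite mem_iota mem_iota /= in hs ht.
    have -> : R <= s < 2 * R by rewrite mul2n -addnn.
    rewrite ht; move=> /(_ isT isT).
    elim: (F) => //= T G IH; rewrite /tris_parity /= -/(tris_parity _ _).
    by case: (tri_parity _ T) => //=; exact: IH.
rewrite size_allpairs !size_iota sF in sP.
(* The [R * (2 * R)] pairs need distinct triangles, of which there are at most [1200] times the
   boundary length; halving gives [600]. *)
rewrite -(@leq_pmul2l 2) // mulnCA (mulnA 2) (leq_trans sP) // (leq_trans hN) //.
by rewrite leq_mul2l size_cat sw leq_add2l.
Qed.

(** * From long detours to the four-point condition *)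

Section Metric.

Variables (T : Type) (d : T -> T -> nat) (K : nat).
Hypothesis d_sym : forall x y, d x y = d y x.
Hypothesis d_tri : forall x y z, d x z <= d x y + d y z.

Definition geodesic (g : nat -> T) (l : nat) : Prop :=
  forall i j, i <= l -> j <= l -> d (g i) (g j) = (i - j) + (j - i).

(** Endpoints match only up to distance zero, since different words may represent the same
    element. *)
Hypothesis d_geod : forall x y, exists2 g, geodesic g (d x y) & d x (g 0) = 0 /\ d (g (d x y)) y = 0.

Hypothesis d_loop : forall p q1 q2 gam R,
  d q1 q2 = d q1 p + d p q2 -> path (fun x y => d x y <= 1) q2 gam -> last q2 gam = q1 ->
  all (fun z => 2 * R <= d p z) (q2 :: gam) -> R * R <= K * (d q1 q2 + size gam).

Definition joined (p : T) (r : nat) (x y : T) (l : nat) : Prop :=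
  exists gam, [/\ path (fun u v => d u v <= 1) x gam, last x gam = y,
    all (fun z => r <= d p z) (x :: gam) & size gam <= l].

Lemma joined_cat p r x y z l m :
  joined p r x y l -> joined p r y z m -> joined p r x z (l + m).
Proof.
case=> g [pg lg ag sg] [h [ph lh ah sh]]; exists (g ++ h); split.
- by rewrite cat_path pg lg.
- by rewrite last_cat lg.
- by rewrite -cat_cons all_cat ag; case/andP: ah.
- by rewrite size_cat leq_add.
Qed.

Lemma joined_sym p r x y l : joined p r x y l -> joined p r y x l.
Proof.
case=> g [pg lg ag sg]; exists (rev (belast x g)); split.
- rewrite -lg rev_path (eq_path (e' := fun u v => d u v <= 1)) // => u v.
  by rewrite d_sym.
- by case: g lg {pg ag sg} => //= y' g _; rewrite rev_cons last_rcons.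
- by rewrite -lg -rev_rcons -lastI all_rev.
- by rewrite size_rev size_belast.
Qed.

Lemma joined_le p r x y l m : l <= m -> joined p r x y l -> joined p r x y m.
Proof. by move=> lm [g [pg lg ag sg]]; exists g; split => //; exact: leq_trans lm. Qed.

Lemma joined_step p r x y : r <= d p x -> r <= d p y -> d x y <= 1 -> joined p r x y 1.
Proof. by move=> rx ry xy; exists [:: y]; split => //=; rewrite ?xy ?rx ?ry. Qed.

Lemma joined_geodesic p r g l i j : geodesic g l -> i <= l -> j <= l ->
  (forall k, k <= l -> r <= d p (g k)) -> joined p r (g i) (g j) (d (g i) (g j)).
Proof.
move=> gg; wlog ij : i j / i <= j.
  move=> h il jl far; case: (leqP i j) => ij; first exact: h.
  by rewrite d_sym; apply: joined_sym; apply: h => //; exact: ltnW.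
move=> il jl far; apply: (@joined_le _ _ _ _ (j - i)); first by rewrite gg // leq_addl.
exists [seq g k | k <- iota i.+1 (j - i)]; split; last by rewrite size_map size_iota.
- rewrite path_map; have : i + (j - i) <= l by rewrite subnKC.
  move: (j - i) => m; elim: m i {il ij} => //= m IH k hk.
  rewrite -addSnnS in hk; have kl : k < l by rewrite (leq_trans _ hk) ?leq_addr.
  rewrite gg ?(ltnW kl) // IH // andbT; clear; lia.
- rewrite last_map; congr g; have {2}<- : i + (j - i) = j by rewrite subnKC.
  by move: (j - i) => m; elim: m i {il ij} => [|m IH] k /=; rewrite ?addn0 // IH addSnnS.
- rewrite -map_cons -/(iota i (j - i).+1) all_map; apply/allP => k.
  by rewrite mem_iota => /andP [_ hk]; apply: far; lia.
Qed.

(** Each point of a geodesic from [x] to [y] is within [D / 2] of one of its ends, hence at least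
    [D / 2] from [p]. The extra [2] pays for the steps of length zero at the ends. *)
Lemma joined_hop p D r x y : 2 * r <= D -> D <= d p x -> D <= d p y -> d x y <= D ->
  joined p r x y (D + 2).
Proof.
move=> rD xD yD xy; have [g gg [g0 g1]] := d_geod x y.
have far k : k <= d x y -> r <= d p (g k).
  move=> hk; have e1 := gg 0 k isT hk; have e2 := gg k (d x y) hk (leqnn _).
  have t1 := d_tri p (g k) (g 0); have t2 := d_tri p (g 0) x; rewrite (d_sym (g 0) x) g0 in t2.
  have t3 := d_tri p (g k) (g (d x y)); have t4 := d_tri p (g (d x y)) y; rewrite g1 in t4.
  rewrite (d_sym (g k)) e1 in t1; rewrite e2 in t3.
  by clear -rD xD yD xy hk t1 t2 t3 t4; lia.
have h1 : joined p r x (g 0) 1.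
  by apply: joined_step; rewrite ?g0 // ?far //; clear -rD xD; lia.
have h2 : joined p r (g (d x y)) y 1.
  by apply: joined_step; rewrite ?g1 // ?far //; clear -rD yD; lia.
have h3 := joined_geodesic gg (leq0n _) (leqnn _) far.
apply: joined_le (joined_cat h1 (joined_cat h3 h2)).
by rewrite gg //; clear -xy; lia.
Qed.

Lemma joined_slide p r g l i j W : geodesic g l -> i <= l -> j <= l ->
  (forall k, k <= l -> r <= d p (g k)) -> d p (g i) <= W -> d p (g j) <= W ->
  joined p r (g i) (g j) (2 * W).
Proof.
move=> gg il jl far iW jW; apply: joined_le (joined_geodesic gg il jl far).
by apply: leq_trans (d_tri _ p _) _; rewrite mul2n -addnn leq_add // d_sym.
Qed.

Definition meets (D : nat) (x : T) (g : nat -> T) (l : nat) : Prop :=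
  exists2 i, i <= l & d x (g i) <= D.

(** Put [R = D %/ 4]. For large [D] one has [D <= 5 * R], so the right side is at most
    [106 * K * D <= 530 * K * R], against [R * R] on the left. *)
Lemma slim_arith D l s : D %/ 4 * (D %/ 4) <= K * (l + s) ->
  l <= 6 * D -> s <= 100 * D -> D <= 3000 * K + 100.
Proof.
move=> h hl hs; rewrite leqNgt; apply/negP => hD.
have h5 : D <= 5 * (D %/ 4) by clear -hD; lia.
have hR : 0 < D %/ 4 by clear -hD; lia.
have : D %/ 4 * (D %/ 4) <= K * 530 * (D %/ 4).
  rewrite -mulnA (leq_trans h) // leq_mul2l; apply/orP; right; clear -hl hs h5; lia.
rewrite leq_pmul2r // => {}h; clear -h h5 hD; lia.
Qed.

(* [p] is far from the sides [b] and [c], so a short path joining the two sides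
   of [p] on [a] away from [p] contradicts [d_loop]; it is found by jumping from
   [a] to [b] and [c] and between these. *)
Lemma slim_bound : exists delta, forall a A b B c C D tau,
  geodesic a A -> geodesic b B -> geodesic c C ->
  d (a 0) (c 0) = 0 -> d (a A) (b 0) = 0 -> d (b B) (c C) = 0 -> tau <= A ->
  (forall i, i <= A -> meets D (a i) c C \/ meets D (a i) b B) ->
  (forall i, i <= C -> meets D (c i) a A \/ meets D (c i) b B) ->
  (forall i, i <= C -> D <= d (a tau) (c i)) -> (forall k, k <= B -> D <= d (a tau) (b k)) ->
  D <= delta.
Proof.
exists (3000 * K + 100) => a A b B c C D tau ga gb gc ac ab bc tA na nc farc farb.
case: (posnP D) => [-> //|D0]; set p := a tau in farc farb.
pose W := 10 * D.
pose r := D %/ 2; have rD : 2 * r <= D by rewrite mulnC leq_divM.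
have rD' : r <= D by rewrite leq_div.
have dp0 i : i <= A -> d p (a i) = (tau - i) + (i - tau) by move=> iA; rewrite ga.
have farc' i : i <= C -> r <= d p (c i) by move=> /farc; exact: leq_trans.
have farb' i : i <= B -> r <= d p (b i) by move=> /farb; exact: leq_trans.
(* The segment of [a] through [p] and the detour form the loop of [d_loop]; the detour avoids the
   ball of radius [r], about [D / 2], whence [R = D %/ 4]. *)
have close jL jR L : jL <= tau -> tau <= jR -> jR <= A -> d p (a jL) <= 3 * D ->
    d p (a jR) <= 3 * D -> joined p r (a jR) (a jL) L -> L <= 100 * D -> 
    D <= 3000 * K + 100.
  move=> hL hR hA dL dR [gam [pg lg ag sg]] hl.
  have geod : d (a jL) (a jR) = d (a jL) p + d p (a jR).
    rewrite !ga // ?(leq_trans hL) //; clear -hL hR; lia.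
  have := d_loop (R := D %/ 4) geod pg lg.
  have r4 : 2 * (D %/ 4) <= r by rewrite /r; clear; lia.
  rewrite (sub_all _ ag) => [/(_ isT) h|z]; last exact: leq_trans.
  apply: (slim_arith h); last exact: leq_trans sg _.
  by rewrite geod (d_sym _ p) (leq_trans (leq_add dL dR)) // -mulnDl.
(* Both sides start at the same point, so nearby points of [a] and [c] have indices differing by at
   most [D]. *)
have idx i j : i <= C -> j <= A -> d (a j) (c i) <= D -> (i <= j + D) && (j <= i + D).
  move=> iC jA h.
  have t1 := d_tri (c 0) (a 0) (c i); have t2 := d_tri (a 0) (a j) (c i).
  have t3 := d_tri (a 0) (c 0) (a j); have t4 := d_tri (c 0) (c i) (a j).
  rewrite (d_sym (c 0) (a 0)) ac gc // in t1; rewrite ga // in t2.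
  rewrite ac ga // in t3; rewrite gc // (d_sym (c i)) in t4.
  by clear -h t1 t2 t3 t4; lia.
have hop x y : D <= d p x -> D <= d p y -> d x y <= D -> joined p r x y (D + 2).
  exact: joined_hop.
(* If an index is truncated at an end of [a], that end also lies on [c] or [b], and is therefore
   still at distance at least [D] from [p]. *)
pose jL := tau - 2 * D; pose jR := minn A (tau + 2 * D).
have a0 : D <= d p (a 0).
  by have := d_tri p (a 0) (c 0); rewrite ac addn0; apply: leq_trans; exact: farc.
have aA : D <= d p (a A).
  by have := d_tri p (a A) (b 0); rewrite ab addn0; apply: leq_trans; exact: farb.
rewrite dp0 // in a0; rewrite dp0 // in aA.
have hLt : jL <= tau by rewrite leq_subr.
have hLA : jL <= A by exact: leq_trans hLt tA.
have hRt : tau <= jR by rewrite leq_min tA leq_addr.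
have hRA : jR <= A by rewrite geq_minl.
have dL : D <= d p (a jL) <= 2 * D by rewrite dp0 // /jL; clear -a0; lia.
have dR : D <= d p (a jR) <= 2 * D by rewrite dp0 // /jR; clear -aA tA; lia.
case/andP: dL => dL1 dL2; case/andP: dR => dR1 dR2.
have dL3 : d p (a jL) <= 3 * D by rewrite (leq_trans dL2) // leq_mul2r orbT.
have dR3 : d p (a jR) <= 3 * D by rewrite (leq_trans dR2) // leq_mul2r orbT.
have far3 x y m : d p x <= m * D -> d x y <= D -> d p y <= m.+1 * D.
  by move=> h1 h2; rewrite (leq_trans (d_tri p x y)) // mulSn addnC leq_add.
have widen x m : m <= 10 -> d p x <= m * D -> d p x <= W.
  by move=> hm h; rewrite (leq_trans h) // leq_mul2r hm orbT.
case: (na jL hLA) => [[i1 i1C e1]|[k1 k1B e1]]; case: (na jR hRA) => [[i2 i2C e2]|[k2 k2B e2]].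
- apply: (close jL jR (D + 2 + (2 * W + (D + 2)))) => //; last by rewrite /W; clear -D0; lia.
  apply: joined_cat (hop _ _ dR1 (farc _ i2C) e2) _.
  apply: joined_cat (joined_slide gc i2C i1C farc' _ _) (joined_sym (hop _ _ dL1 (farc _ i1C) e1)).
    exact: (@widen _ 3 isT (far3 _ _ 2 dR2 e2)).
  exact: (@widen _ 3 isT (far3 _ _ 2 dL2 e1)).
(* The left point is near [c], the right one near [b]. The detour follows [c] up to [ie]: either
   this is the common end with [b], or the point is near [b], or it is near a point of [a] to the
   right of [p], which then replaces [jR]. *)
- pose ie := minn C (tau + 2 * D); have ieC : ie <= C by rewrite geq_minl.
  have /andP [i1a i1b] := idx _ _ i1C hLA e1.
  have d1 := far3 _ _ 2 dL2 e1.
  have de : d p (c ie) <= 8 * D.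
    rewrite (leq_trans (d_tri p (c i1) _)) // gc // /ie.
    by clear -d1 i1C i1a i1b tA; rewrite /jL in i1a i1b; lia.
  have jc : joined p r (c ie) (a jL) (2 * W + (D + 2)).
    apply: joined_cat (joined_slide gc ieC i1C farc' _ _) (joined_sym (hop _ _ dL1 (farc _ i1C) e1)).
      exact: (@widen _ 8 isT de).
    exact: (@widen _ 3 isT d1).
  have viab k : k <= B -> d (c ie) (b k) <= D -> D <= 3000 * K + 100.
    move=> kB e; apply: (close jL jR (D + 2 + (2 * W + (D + 2 + (2 * W + (D + 2)))))) => //.
      apply: joined_cat (hop _ _ dR1 (farb _ k2B) e2) _.
      have dk := far3 _ _ 8 de e.
      apply: joined_cat (joined_slide gb k2B kB farb' _ _) _.
      - exact: (@widen _ 3 isT (far3 _ _ 2 dR2 e2)).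
      - exact: (@widen _ 9 isT dk).
      exact: joined_cat (joined_sym (hop _ _ (farc _ ieC) (farb _ kB) e)) jc.
    by rewrite /W; clear -D0; lia.
  have [eC|eT] : ie = C \/ ie = tau + 2 * D by rewrite /ie; clear; lia.
    by apply: (viab B (leqnn _)); rewrite eC d_sym bc.
  case: (nc ie ieC) => [[j jA ej]|[k kB ek]]; last exact: viab ek.
  have ej' := ej; rewrite d_sym in ej'.
  have /andP [ja jb] := idx _ _ ieC jA ej'; rewrite eT in ja jb.
  have tj : tau <= j by clear -ja; lia.
  have dj : D <= d p (a j) <= 3 * D by rewrite dp0 //; clear -ja jb; lia.
  case/andP: dj => dj1 dj2.
  apply: (close jL j (D + 2 + (2 * W + (D + 2)))) => //; last by rewrite /W; clear -D0; lia.
  exact: joined_cat (hop _ _ dj1 (farc _ ieC) ej') jc.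
(* The opposite situation: [c] is followed back to the index [jL]. If this is [0], the common end
   with [a] is reached; otherwise the point is near [a] to the left of [p], or near [b]. *)
- have /andP [i2a i2b] := idx _ _ i2C hRA e2.
  have tR : tau + D <= jR by move: dR1; rewrite dp0 //; clear -hRt; lia.
  have jLC : jL <= C by rewrite (leq_trans _ i2C) // (leq_trans hLt) //; clear -tR i2b; lia.
  have d2 := far3 _ _ 2 dR2 e2.
  have de : d p (c jL) <= 8 * D.
    rewrite (leq_trans (d_tri p (c i2) _)) // gc // /jL.
    by clear -d2 i2a i2b tA; rewrite /jR in i2a i2b; lia.
  have jc : joined p r (a jR) (c jL) (D + 2 + 2 * W).
    apply: joined_cat (hop _ _ dR1 (farc _ i2C) e2) (joined_slide gc i2C jLC farc' _ _).
      exact: (@widen _ 3 isT d2).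
    exact: (@widen _ 8 isT de).
  have viaa j : D <= d p (a j) -> d p (a j) <= 3 * D -> j <= tau -> d (a j) (c jL) <= D -> D <= 3000 * K + 100.
    move=> j1 j2 jt ej; apply: (close j jR (D + 2 + 2 * W + (D + 2))) => //; last by rewrite /W; clear -D0; lia.
    exact: joined_cat jc (joined_sym (hop _ _ j1 (farc _ jLC) ej)).
  have [eL|gL] := posnP jL; first by apply: (viaa jL) => //; rewrite eL ac.
  case: (nc jL jLC) => [[j jA ej]|[k kB ek]].
    rewrite d_sym in ej; have /andP [ja jb] := idx _ _ jLC jA ej.
    have jt : j <= tau by rewrite /jL in gL ja jb; clear -gL jb; lia.
    have dj : D <= d p (a j) <= 3 * D by rewrite dp0 //; rewrite /jL in gL ja jb; clear -gL ja jb; lia.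
    by case/andP: dj => dj1 dj2; exact: (viaa j).
  apply: (close jL jR (D + 2 + 2 * W + (D + 2 + (2 * W + (D + 2))))) => //; last by rewrite /W; clear -D0; lia.
  apply: joined_cat jc (joined_cat (hop _ _ (farc _ jLC) (farb _ kB) ek) _).
  apply: joined_cat (joined_slide gb kB k1B farb' _ _) (joined_sym (hop _ _ dL1 (farb _ k1B) e1)).
    exact: (@widen _ 9 isT (far3 _ _ 8 de ek)).
  exact: (@widen _ 3 isT (far3 _ _ 2 dL2 e1)).
- apply: (close jL jR (D + 2 + (2 * W + (D + 2)))) => //; last by rewrite /W; clear -D0; lia.
  apply: joined_cat (hop _ _ dR1 (farb _ k2B) e2) _.
  apply: joined_cat (joined_slide gb k2B k1B farb' _ _) (joined_sym (hop _ _ dL1 (farb _ k1B) e1)).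
    exact: (@widen _ 3 isT (far3 _ _ 2 dR2 e2)).
  exact: (@widen _ 3 isT (far3 _ _ 2 dL2 e1)).
Qed.

Definition reverse (g : nat -> T) (l : nat) : nat -> T := fun i => g (l - i).

Lemma geodesic_reverse g l : geodesic g l -> geodesic (reverse g l) l.
Proof. by move=> gg i j il jl; rewrite /reverse gg ?leq_subr //; clear -il jl; lia. Qed.

Lemma meets_reverse D x g l : meets D x g l -> meets D x (reverse g l) l.
Proof. by case=> i il h; exists (l - i); rewrite ?leq_subr // /reverse subKn. Qed.

Lemma meets_le D D' x g l : D <= D' -> meets D x g l -> meets D' x g l.
Proof. by move=> DD [i il h]; exists i => //; exact: leq_trans DD. Qed.

Lemma not_meets D x g l : ~ meets D x g l -> forall i, i <= l -> D.+1 <= d x (g i).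
Proof. by move=> h i il; rewrite ltnNge; apply/negP => hd; apply: h; exists i. Qed.

Definition triangle (a : nat -> T) A b B c C : Prop :=
  [/\ geodesic a A, geodesic b B & geodesic c C] /\
  [/\ d (a 0) (c 0) = 0, d (a A) (b 0) = 0 & d (b B) (c C) = 0].

Definition slim D (a : nat -> T) A b B c C : Prop :=
  [/\ forall i, i <= A -> meets D (a i) c C \/ meets D (a i) b B,
      forall i, i <= B -> meets D (b i) a A \/ meets D (b i) c C &
      forall i, i <= C -> meets D (c i) a A \/ meets D (c i) b B].

(** Descent from the trivial constant [A + B + C]. If a triangle is slim for [D.+1] but not for [D],
    some point is at distance at least [D.+1] from both other sides, and [slim_bound] limits
    [D.+1]. *)
Lemma triangles_slim : exists delta, forall a A b B c C,
  triangle a A b B c C -> slim delta a A b B c C.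
Proof.
have [delta sb] := slim_bound; exists delta => a A b B c C [[ga gb gc] [ac ab bc]].
have start : slim (A + B + C) a A b B c C.
  split=> i hi.
  - left; exists 0 => //; rewrite (leq_trans (d_tri _ (a 0) _)) // ac ga //.
    clear -hi; lia.
  - left; exists A => //; rewrite (leq_trans (d_tri _ (b 0) _)) // (d_sym (b 0)) ab gb //.
    clear -hi; lia.
  - left; exists 0 => //; rewrite (leq_trans (d_tri _ (c 0) _)) // (d_sym (c 0)) ac gc //.
    clear -hi; lia.
elim: (A + B + C) start => [|D IH] [sa sB sC].
  by split=> i hi; [case: (sa i hi)|case: (sB i hi)|case: (sC i hi)] => h;
    [left|right|left|right|left|right]; apply: meets_le h.
have [le|gt] := leqP D.+1 delta.
  by split=> i hi; [case: (sa i hi)|case: (sB i hi)|case: (sC i hi)] => h;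
    [left|right|left|right|left|right]; apply: meets_le h.
have far (P Q : Prop) : (~ P -> ~ Q -> D.+1 <= delta) -> P \/ Q.
  move=> h; have [hP|hP] := pselect P; first by left.
  have [hQ|hQ] := pselect Q; first by right.
  by move: (h hP hQ); rewrite leqNgt gt.
apply: IH; split=> i hi; apply: far => /not_meets h1 /not_meets h2.
- exact: (sb a A b B c C D.+1 i).
(* [slim_bound] treats points of its first side only; the other sides are covered by rotating the
   triangle, with sides reversed to match the ends. *)
- apply: (sb b B (reverse c C) C (reverse a A) A D.+1 i) => //.
  + exact: geodesic_reverse.
  + exact: geodesic_reverse.
  + by rewrite /reverse subn0 d_sym.
  + by rewrite /reverse subn0.
  + by rewrite /reverse !subnn d_sym.
  + by move=> j hj; case: (sB j hj) => h; [left|right]; exact: meets_reverse.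
  + move=> j hj; case: (sa (A - j) (leq_subr _ _)) => h; [right|left] => //.
    exact: meets_reverse.
  + by move=> j hj; apply: h1; exact: leq_subr.
  + by move=> j hj; apply: h2; exact: leq_subr.
- apply: (sb c C (reverse b B) B a A D.+1 i) => //.
  + exact: geodesic_reverse.
  + by rewrite d_sym.
  + by rewrite /reverse subn0 d_sym.
  + by rewrite /reverse subnn d_sym.
  + by move=> j hj; case: (sC j hj) => h; [left|right] => //; exact: meets_reverse.
  + by move=> j hj; case: (sa j hj) => h; [left|right] => //; exact: meets_reverse.
  + by move=> j hj; apply: h2; exact: leq_subr.
Qed.

Lemma between x y g i : geodesic g (d x y) -> d x (g 0) = 0 -> d (g (d x y)) y = 0 ->
  i <= d x y -> d x (g i) + d (g i) y <= d x y.
Proof.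
move=> gg g0 g1 hi.
have := d_tri x (g 0) (g i); have := d_tri (g i) (g (d x y)) y.
rewrite g0 g1 !gg //; clear -hi; lia.
Qed.

(** Some point of a geodesic from [x] to [y] is close to both other sides of the triangle with apex
    [w]; its distance to [w] is then the Gromov product up to an error. In the triangle with apex
    [z] the same point is near one of the other sides, which selects the term of the maximum. *)
Lemma four_point : exists delta, forall x y z w,
  d x y + d z w <= maxn (d x z + d y w) (d x w + d y z) + 2 * delta.
Proof.
have [D sl] := triangles_slim; exists (3 * D + 1) => x y z w.
have [a ga [a0 a1]] := d_geod x y.
have tri v b c : geodesic b (d y v) -> d y (b 0) = 0 -> d (b (d y v)) v = 0 ->
    geodesic c (d x v) -> d x (c 0) = 0 -> d (c (d x v)) v = 0 ->
    triangle a (d x y) b (d y v) c (d x v).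
  move=> gb b0 b1 gc c0 c1; split; first by [].
  split; apply/eqP; rewrite -leqn0.
  - by rewrite (leq_trans (d_tri _ x _)) // (d_sym _ x) a0 c0.
  - by rewrite (leq_trans (d_tri _ y _)) // a1 b0.
  - by rewrite (leq_trans (d_tri _ v _)) // b1 (d_sym v) c1.
have [b gb [b0 b1]] := d_geod y w; have [c gc [c0 c1]] := d_geod x w.
have [sa _ _] := sl _ _ _ _ _ _ (tri w b c gb b0 b1 gc c0 c1).
(* At the least index near the side to [w] from [y], the previous point is near the side from [x];
   stepping back costs one, hence [D.+1]. *)
have [i hi [nc nb]] : exists2 i, i <= d x y & meets D (a i) c (d x w) /\ meets D.+1 (a i) b (d y w).
  have ex : exists k, `[< k <= d x y /\ meets D (a k) b (d y w) >].
    exists (d x y); apply/asboolP; split=> //; exists 0 => //.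
    by rewrite (leq_trans (d_tri _ y _)) // a1 b0.
  case: (ex_minnP ex) => -[|k] /asboolP [hk mk] kmin.
    exists 0 => //; split; last exact: meets_le mk.
    exists 0 => //; by rewrite (leq_trans (d_tri _ x _)) // (d_sym _ x) a0 c0.
  exists k; first exact: ltnW.
  split.
    case: (sa k (ltnW hk)) => // h.
    by have := kmin k (asboolT (conj (ltnW hk) h)); rewrite ltnn.
  case: mk => j hj dj; exists j => //.
  rewrite (leq_trans (d_tri _ (a k.+1) _)) // ga // ?(ltnW hk) //.
  clear -dj; lia.
case: nc => j hj dj; case: nb => k hk dk.
have e1 := between gc c0 c1 hj; have e2 := between gb b0 b1 hk.
have f1 : d x y + 2 * d (a i) w <= d x w + d y w + 4 * D + 2.
  have t1 := d_tri x (a i) y; have t2 := d_tri x (c j) (a i); have t3 := d_tri (a i) (c j) w.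
  have t4 := d_tri (a i) (b k) y; have t5 := d_tri (a i) (b k) w.
  rewrite (d_sym (c j) (a i)) in t2; rewrite (d_sym (b k) y) in t4.
  clear -t1 t2 t3 t4 t5 e1 e2 dj dk; lia.
have [b' gb' [b0' b1']] := d_geod y z; have [c' gc' [c0' c1']] := d_geod x z.
have [sa' _ _] := sl _ _ _ _ _ _ (tri z b' c' gb' b0' b1' gc' c0' c1').
case: (sa' i hi) => -[m hm dm].
  have e3 := between gc' c0' c1' hm.
  have t1 := d_tri x (c' m) w; have t2 := d_tri z (c' m) w; have t3 := d_tri (c' m) (a i) w.
  rewrite (d_sym z (c' m)) in t2; rewrite (d_sym (c' m) (a i)) in t3.
  clear -f1 e3 t1 t2 t3 dm; lia.
have e3 := between gb' b0' b1' hm.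
have t1 := d_tri y (b' m) w; have t2 := d_tri z (b' m) w; have t3 := d_tri (b' m) (a i) w.
rewrite (d_sym z (b' m)) in t2; rewrite (d_sym (b' m) (a i)) in t3.
clear -f1 e3 t1 t2 t3 dm; lia.
Qed.

End Metric.

Lemma Hn3_dist_dist n u v k : valid_word n u -> valid_word n v -> Hn3_dist n u v k -> k = dist n u v.
Proof.
move=> vu vv [[w [vw sw ew]] kmin]; have [x [vx sx ex]] := dist_joins vu vv.
by apply/eqP; rewrite eqn_leq -{1}sx kmin //= -sw dist_le.
Qed.

Lemma valid_take n w i : valid_word n w -> valid_word n (take i w).
Proof. by rewrite -{1}(cat_take_drop i w) valid_cat => /andP []. Qed.

Theorem theorem7p1 (n : nat) : 11 <= n -> n != 12 -> n != 14 -> Hn3_hyperbolic n.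
Proof.
move=> n11 n12 n14.
(* On valid words a joining word always exists, so [dist] never takes its default value and the
   metric laws hold without side conditions. *)
pose point := {w : seq letter | valid_word n w}.
pose pt u (vu : valid_word n u) : point := exist _ u vu.
pose d (x y : point) := dist n (val x) (val y).
have d_sym x y : d x y = d y x by apply: dist_sym; exact: valP.
have d_tri x y z : d x z <= d x y + d y z by apply: dist_tri; exact: valP.
have d_geod x y : exists2 g, geodesic d g (d x y) & d x (g 0) = 0 /\ d (g (d x y)) y = 0.
  have [w [vw sw ew]] := dist_joins (valP x) (valP y).
  have vg i : valid_word n (val x ++ take i w) by rewrite valid_cat (valP x) valid_take.
  have eg : size w = dist n (val x) (val x ++ w).
    by rewrite sw; apply: dist_eq; [constructor | exact: Hn3_sym].
  exists (fun i => pt _ (vg i)); last split.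
  - have le i j : i <= j -> j <= d x y -> d (pt _ (vg i)) (pt _ (vg j)) = j - i.
      move=> ij jl; apply: (dist_geod_take (valP x) vw eg ij); by rewrite sw.
    move=> i j il jl; case: (leqP i j) => ij.
      by rewrite (le _ _ ij jl) (eqP (_ : i - j == 0)) ?subn_eq0.
    by rewrite d_sym (le _ _ (ltnW ij) il) (eqP (_ : j - i == 0)) ?addn0 // subn_eq0 ltnW.
  - by rewrite /d /= take0 cats0 dist0.
  - by rewrite /d /= -sw take_size (dist_eq ew (Hn3_refl n _)) dist0.
have d_loop p q1 q2 gam R : d q1 q2 = d q1 p + d p q2 ->
    path (fun x y => d x y <= 1) q2 gam -> last q2 gam = q1 ->
    all (fun z => 2 * R <= d p z) (q2 :: gam) -> R * R <= 600 * (d q1 q2 + size gam).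
  move=> e hp hl far; rewrite -(size_map val).
  apply: (loop_area (p := val p)) => //; try exact: valP.
  - by rewrite -map_cons all_map; apply/allP => z _; exact: valP.
  - by rewrite path_map.
  - by rewrite last_map hl.
  - by rewrite -map_cons all_map.
have [delta h] := four_point d_sym d_tri d_geod d_loop.
exists delta => x y z w vx vy vz vw dxy dzw dxz dyw dxw dyz.
do 6!move=> /Hn3_dist_dist ->//.
exact: (h (pt x vx) (pt y vy) (pt z vz) (pt w vw)).
Qed.
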